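(* The normalized semicircle transform $\mathcal W$ fulfills $$\mathcal W Y_n^k=\mathrm w_n\,Z_n^k\qquad\text{for all } n\in\mathbb N_0,\ k\in\{-n,\dots,n\},$$ with the singular values $\mathrm w_n:=\|\mathcal W Y_n^k\|_{L^2(\mathrm{SO}(3))}$ (which do not depend on $k$) and the functions $$Z_n^k:=\mathrm w_n^{-1}\sum_{j=-n}^n\lambda_n^j\,\overline{D_n^{k,j}}\in L^2(\mathrm{SO}(3)),$$ which are orthonormal in $L^2(\mathrm{SO}(3))$ (for $n\in\mathbb N_0$, $k\in\{-n,\dots,n\}$). Here $\lambda_0^0:=2(4\pi)^{-3/2}$ and, for $n\in\mathbb N$ and $j\in\{1,\dots,n\}$ with $n+j$ even, $$\lambda_n^j:=\frac{(-1)^j}{4\pi}\sqrt{\frac{2n+1}{4\pi}\frac{(n-j)!}{(n+j)!}}\ \frac{j\,(n-2)!!\,(n+j-1)!!}{(n-j)!!\,(n+1)!!}\cdot\begin{cases}2,& n\text{ even},\\ \pi,& n\text{ odd},\end{cases}$$ $\lambda_n^{-j}:=(-1)^j\lambda_n^j$, and $\lambda_n^j:=0$ otherwise. Moreover, there are constants $C_1,C_2>0$ such that $$C_1(n+1)^{-1/2}\le \mathrm w_n\le C_2(n+1)^{-1/2}\qquad\text{for all } n\in\mathbb N_0.$$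
   Context: Let $\mathbb S^2=\{\xi\in\mathbb R^3:\|\xi\|=1\}$, $\mathbb T=\mathbb R/(2\pi\mathbb Z)$, and $\Phi(\varphi,\vartheta)=(\cos\varphi\sin\vartheta,\sin\varphi\sin\vartheta,\cos\vartheta)\in\mathbb S^2$ for $\varphi\in\mathbb T,\vartheta\in[0,\pi]$. Every $Q\in\mathrm{SO}(3)$ can be written in Euler angles as $Q=\Psi(\alpha,\beta,\gamma):=R_3(\alpha)R_2(\beta)R_3(\gamma)$, $\alpha,\gamma\in\mathbb T$, $\beta\in[0,\pi]$, where $$R_3(\alpha)=\begin{pmatrix}\cos\alpha&-\sin\alpha&0\\ \sin\alpha&\cos\alpha&0\\0&0&1\end{pmatrix},\quad R_2(\beta)=\begin{pmatrix}\cos\beta&0&\sin\beta\\0&1&0\\-\sin\beta&0&\cos\beta\end{pmatrix}.$$ The space $L^2(\mathrm{SO}(3))$ (complex-valued functions) is taken with respect to the rotationally invariant measure $\sigma_{\mathrm{SO}(3)}$ given by $\int f\,d\sigma_{\mathrm{SO}(3)}=\int_0^{2\pi}\int_0^\pi\int_0^{2\pi}f(\Psi(\alpha,\beta,\gamma))\sin\beta\,d\alpha\,d\beta\,d\gamma$ (total mass $8\pi^2$). Normalized semicircle transform of a function $f$ on $\mathbb S^2$: $\mathcal W f(Q):=\frac1{4\pi}\int_0^\pi f(Q\,\Phi(0,\vartheta))\sin\vartheta\,d\vartheta$, $Q\in\mathrm{SO}(3)$. Spherical harmonics: for $n\in\mathbb N_0$, $k=-n,\dots,n$, $Y_n^k(\Phi(\varphi,\vartheta))=\sqrt{\frac{2n+1}{4\pi}\frac{(n-k)!}{(n+k)!}}\,P_n^k(\cos\vartheta)\,e^{ik\varphi}$,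 where $P_n^k(t)=\frac{(-1)^k}{2^nn!}(1-t^2)^{k/2}\frac{d^{n+k}}{dt^{n+k}}(t^2-1)^n$ for $k\ge0$ and $P_n^{-k}=(-1)^k\frac{(n-k)!}{(n+k)!}P_n^k$. Rotational harmonics (Wigner D-functions): for $n\in\mathbb N_0$, $k,j\in\{-n,\dots,n\}$, $D_n^{k,j}(\Psi(\alpha,\beta,\gamma))=e^{-ik\alpha}\,d_n^{k,j}(\cos\beta)\,e^{-ij\gamma}$ with the Wigner d-functions $$d_n^{k,j}(t)=\frac{(-1)^{n-j}}{2^n}\sqrt{\frac{(n+k)!\,(1-t)^{j-k}}{(n-j)!\,(n+j)!\,(n-k)!\,(1+t)^{j+k}}}\ \frac{d^{n-k}}{dt^{n-k}}\frac{(1+t)^{n+j}}{(1-t)^{-n+j}},$$ so that $Y_n^k(Q^\top\xi)=\sum_{j=-n}^nD_n^{j,k}(Q)\,Y_n^j(\xi)$. Double factorials use the convention $(-1)!!=0!!=1$. *)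

(* Defs.v *)
From mathcomp Require Export all_boot all_order all_algebra.
From mathcomp Require Export complex.
From mathcomp Require Export all_classical all_reals all_analysis.
Import Order.TTheory GRing.Theory Num.Theory.
Import numFieldNormedType.Exports.
Set Implicit Arguments.
Unset Strict Implicit.
Unset Printing Implicit Defensive.
Local Open Scope classical_set_scope.
Local Open Scope complex_scope.
Local Open Scope ring_scope.

Definition expi {R : realType} (x : R) : R[i] := cos x +i* sin x.

Definition SO3 {R : realType} : set 'M[R]_3 :=
  [set Q | Q *m Q^T = 1%:M /\ \det Q = 1].

Definition Phi {R : realType} (phi theta : R) : 'cV[R]_3 :=
  \col_(i < 3) [:: cos phi * sin theta; sin phi * sin theta; cos theta]`_i.

Definition R3 {R : realType} (a : R) : 'M[R]_3 :=
  \matrix_(i < 3, j < 3)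
    (nth [::] [:: [:: cos a; - sin a; 0];
               [:: sin a;   cos a; 0];
               [:: 0;       0;     1]] i)`_j.

Definition R2 {R : realType} (b : R) : 'M[R]_3 :=
  \matrix_(i < 3, j < 3)
    (nth [::] [:: [:: cos b;   0; sin b];
               [:: 0;       1; 0];
               [:: - sin b; 0; cos b]] i)`_j.

Definition Psi {R : realType} (a b c : R) : 'M[R]_3 :=
  R3 a *m R2 b *m R3 c.

(* The angles of T = R / 2piZ are represented in [0, 2pi[.  The coordinates are
   not unique at the poles of the sphere and at beta = 0, pi, where an arbitrary
   choice is made: the functions Ynk and wignerD below do not depend on it. *)
Definition sphere_coord {R : realType} (x : 'cV[R]_3) : R * R :=
  xget (0, 0) [set p | [/\ 0 <= p.1 < 2 * pi, 0 <= p.2 <= pi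
                         & Phi p.1 p.2 = x]].

Definition euler_angles {R : realType} (Q : 'M[R]_3) : R * R * R :=
  xget (0, 0, 0) [set p | [/\ 0 <= p.1.1 < 2 * pi, 0 <= p.1.2 <= pi,
                              0 <= p.2 < 2 * pi
                            & Psi p.1.1 p.1.2 p.2 = Q]].

(* Functions on SO(3) are functions on 'M[R]_3 of which only the restriction to
   SO3 matters.  The rotationally invariant measure, of total mass 8 pi^2, is
   given through its integral in Euler angles. *)
Definition integralSO3 {R : realType} (f : 'M[R]_3 -> \bar R) : \bar R :=
  (\int[@lebesgue_measure R]_(c in `[0%R, (2 * pi)%R]%classic)
   \int[@lebesgue_measure R]_(b in `[0%R, pi%R]%classic)
   \int[@lebesgue_measure R]_(a in `[0%R, (2 * pi)%R]%classic)
     (f (Psi a b c) * (sin b)%:E))%E.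

Definition cintegralSO3 {R : realType} (f : 'M[R]_3 -> R[i]) : R[i] :=
  fine (integralSO3 (fun Q => (complex.Re (f Q))%:E)) +i*
  fine (integralSO3 (fun Q => (complex.Im (f Q))%:E)).

Definition sqnormSO3 {R : realType} (f : 'M[R]_3 -> R[i]) : \bar R :=
  integralSO3 (fun Q => (Normc.normc (f Q) ^+ 2)%:E).

Definition L2normSO3 {R : realType} (f : 'M[R]_3 -> R[i]) : R :=
  Num.sqrt (fine (sqnormSO3 f)).

Definition L2dotSO3 {R : realType} (f g : 'M[R]_3 -> R[i]) : R[i] :=
  cintegralSO3 (fun Q => f Q * (g Q)^*).

Definition euler_box {R : realType} : set (R * R * R) :=
  `[0, 2 * pi]%classic `*` `[0, pi]%classic `*` `[0, 2 * pi]%classic.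

(* Measurability is tested in Euler angles: Psi is injective, with measurable
   inverse, off a null set of the box. *)
Definition in_L2SO3 {R : realType} (f : 'M[R]_3 -> R[i]) : Prop :=
  [/\ measurable_fun euler_box
        (fun p : R * R * R => complex.Re (f (Psi p.1.1 p.1.2 p.2))),
      measurable_fun euler_box
        (fun p : R * R * R => complex.Im (f (Psi p.1.1 p.1.2 p.2)))
    & (sqnormSO3 f < +oo)%E].

Definition cintegral {R : realType} (D : set R) (f : R -> R[i]) : R[i] :=
  (\int[@lebesgue_measure R]_(x in D) complex.Re (f x)) +i*
  (\int[@lebesgue_measure R]_(x in D) complex.Im (f x)).

Definition semicircle {R : realType} (f : 'cV[R]_3 -> R[i]) (Q : 'M[R]_3)
    : R[i] :=
  ((4 * pi)^-1)%:C *
  cintegral `[0, pi]%classic (fun t => f (Q *m Phi 0 t) * (sin t)%:C).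

(* Degrees are in nat, orders in int; all arguments of factz are nonnegative in
   the range -n <= k, j <= n. *)
Definition order_range (n : nat) (k : int) : Prop := - n%:Z <= k <= n%:Z.

Definition factz {R : realType} (m : int) : R := (`|m|%N)`!%:R.

Definition legendre {R : realType} (n m : nat) (t : R) : R :=
  (-1) ^+ m / (2 ^+ n * n`!%:R) * Num.sqrt (1 - t ^+ 2) ^+ m *
  derive1n (n + m) (fun s : R => (s ^+ 2 - 1) ^+ n) t.

Definition assoc_legendre {R : realType} (n : nat) (k : int) (t : R) : R :=
  if 0 <= k then legendre n `|k|%N t
  else (-1) ^+ `|k|%N * (factz (n%:Z - `|k|%N%:Z) / factz (n%:Z + `|k|%N%:Z)) *
       legendre n `|k|%N t.

Definition Ynk {R : realType} (n : nat) (k : int) (x : 'cV[R]_3) : R[i] :=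
  let: (phi, theta) := sphere_coord x in
  (Num.sqrt ((2 * n%:R + 1) / (4 * pi) * (factz (n%:Z - k) / factz (n%:Z + k))) *
   assoc_legendre n k (cos theta))%:C * expi (k%:~R * phi).

Definition wigner_d_formula {R : realType} (n : nat) (k j : int) (t : R) : R :=
  (-1) ^ (n%:Z - j) / 2 ^+ n *
  Num.sqrt (factz (n%:Z + k) * (1 - t) ^ (j - k) /
            (factz (n%:Z - j) * factz (n%:Z + j) * factz (n%:Z - k) *
             (1 + t) ^ (j + k))) *
  derive1n `|n%:Z - k|%N
    (fun s : R => (1 + s) ^ (n%:Z + j) / (1 - s) ^ (- n%:Z + j)) t.

(* At t = 1 and t = -1 the formula can involve division by 0; there the Wigner
   d-function is its continuous extension. *)
Definition wigner_d {R : realType} (n : nat) (k j : int) (t : R) : R :=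
  if t == 1 then lim (wigner_d_formula n k j s @[s --> (1 : R)^'-])
  else if t == -1 then lim (wigner_d_formula n k j s @[s --> (- 1 : R)^'+])
  else wigner_d_formula n k j t.

Definition wignerD {R : realType} (n : nat) (k j : int) (Q : 'M[R]_3) : R[i] :=
  let: (a, b, c) := euler_angles Q in
  expi (- (k%:~R * a)) * (wigner_d n k j (cos b))%:C * expi (- (j%:~R * c)).

Fixpoint dfact (n : nat) : nat :=
  match n with
  | 0 | 1 => 1
  | m.+2 => (n * dfact m)%N
  end.

(* For n = 1 the truncated n - 2 is 0, in accordance with (-1)!! = 0!! = 1. *)
Definition lambda_pos {R : realType} (n j : nat) : R :=
  (-1) ^+ j / (4 * pi) *
  Num.sqrt ((2 * n%:R + 1) / (4 * pi) * ((n - j)`!%:R / (n + j)`!%:R)) *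
  ((j * dfact (n - 2) * dfact (n + j - 1))%N%:R /
   (dfact (n - j) * dfact (n + 1))%N%:R) *
  (if odd n then pi else 2).

Definition lambda {R : realType} (n : nat) (j : int) : R :=
  if (n == 0%N) && (j == 0) then 2 * (4 * pi) `^ (- (3 / 2))
  else if (1 <= `|j| <= n)%N && ~~ odd (n + `|j|)%N then
    if 0 < j then lambda_pos n `|j|%N
    else (-1) ^+ `|j|%N * lambda_pos n `|j|%N
  else 0.

(* The norm of the transform of Ynk n k does not depend on the order k, so k = 0
   is taken. *)
Definition w {R : realType} (n : nat) : R := L2normSO3 (semicircle (@Ynk R n 0)).

Definition Znk {R : realType} (n : nat) (k : int) (Q : 'M[R]_3) : R[i] :=
  ((w n)^-1)%:C *
  \sum_(i < (2 * n).+1)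
    let j := i%:Z - n%:Z in (lambda n j)%:C * (wignerD n k j Q)^*.

(* Main.v *)
Require Import Defs.
From mathcomp Require Import ring lra zify.
Import Order.TTheory GRing.Theory Num.Theory.
Import numFieldNormedType.Exports.
Local Open Scope classical_set_scope.
Local Open Scope complex_scope.
Local Open Scope ring_scope.
Set Implicit Arguments.
Unset Strict Implicit.
Unset Printing Implicit Defensive.

(** Everything is computed in one family of polynomials.  With c and s the cosine
    and sine of b/2, put f(p, q, b) = (c + s X)^p (c X - s)^q: the image of X^q,
    homogenised in degree p + q, under an element of SU(2) above the rotation
    R2 b.

    Rodrigues' formulas are Taylor coefficients, and rescaling the Taylor
    variable by the sine turns them into coefficients of these polynomials.  For
    the Wigner function this gives d_n^(n-m,n-j)(cos b), up to the constant
    [wignorm], as the coefficient of X^m in f(2n-j, j, b) ([wigner_dE]).  For the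
    spherical harmonics it gives Y_n^(n-m)(x), up to the constant [sphnorm], as
    the coefficient of X^m in q_x^n, where
    q_x = (x1 - i x2)/2 X^2 + x3 X - (x1 + i x2)/2
    ([YnkE]).  On q_x, the rotation R3 acts by rescaling X and R2 by the Moebius
    map (c X - s)/(c + s X).  Expanding q_x^n after this substitution is the
    rotation formula of the spherical harmonics
    ([null_form_R3], [null_form_R2]).  So the transform of Y_n^(n-m) at
    the Euler angles (a, b, c) is a trigonometric sum ([semicircle_Psi]), whose
    coefficients contain the integrals of those of f(n, n, b) against sin b
    ([meridian]).

    The coefficients of f satisfy two first order ladder relations
    ([rot_ladder_down], [rot_ladder_up]).  Integrated against the sine, they
    yield the orthogonality of the Wigner functions of different degrees
    ([rot_orthogonal]), their norms up to a Beta integral ([rot_norm_binomial],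
    [rot_beta]), and a two step recurrence for [meridian] ([meridian_ladder]),
    which starts at a Wallis integral and produces the numbers lambda
    ([lambdaE]).

    Orthogonality of the exponentials in a and c does the rest: the squared norm
    of the transform is 1/(8 pi) times a weighted sum of squares of [meridian],
    which does not see the order ([transform_dot]).  That sum is a second moment
    of a convolution of central binomial coefficients, with a closed value
    ([central_second_moment]); what is left is a squared ratio of double
    factorials, which decays like the inverse of n + 1 because n+1 times the
    square increases and n+2 times it decreases along each parity
    ([dfact_ratio_bounds]).

    Orders are written n - m and n - j with 0 <= m, j <= 2n, so that m and j are
    exponents of X. *)

(** * Taylor coefficients and the polynomials of half-angle rotations *)

Lemma coef_comp_shift (F : comNzRingType) (P : {poly F}) (x : F) i :
  (P \Po ('X + x%:P))`_i = P^`N(i).[x].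
Proof.
elim/poly_ind: P i => [|P c IH] i; first by rewrite comp_poly0 coef0 linear0 horner0.
rewrite comp_poly_MXaddC mulrDr coefD coefC coefD coefMX coefMC.
case: i => [|i] /=.
  rewrite nderivn0 IH nderivn0 !hornerE; ring.
by rewrite nderivnMXaddC !IH hornerD hornerM hornerX addr0.
Qed.

Lemma coef_comp_scale (F : comNzRingType) (P : {poly F}) (z : F) i :
  (P \Po (z *: 'X))`_i = z ^+ i * P`_i.
Proof.
elim/poly_ind: P i => [|P c IH] i; first by rewrite comp_poly0 coef0 mulr0.
rewrite comp_poly_MXaddC -scalerAr coefD coefC coefZ coefMX coefD coefC coefMX.
case: i => [|i] /=; first by rewrite mulr0 expr0 mul1r.
by rewrite IH !addr0 mulrA -exprS.
Qed.

(** The polynomial f(p, q) of the introduction, for arbitrary c and s: the two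
    factors are the denominator and the numerator of the Moebius map. *)
Definition rotpoly (F : comNzRingType) (c s : F) (p q : nat) : {poly F} :=
  (c%:P + s%:P * 'X) ^+ p * (c%:P * 'X - s%:P) ^+ q.

(** Twice the derivative in the angle when c and s are the cosine and sine of
    half of it: the derivative of c + s X is then half of c X - s, and that of
    c X - s is minus half of c + s X. *)
Definition rotpoly_deriv (F : comNzRingType) (c s : F) (p q : nat) : {poly F} :=
  p%:R * (rotpoly c s p.-1 q.+1) - q%:R * rotpoly c s p.+1 q.-1.

Section Ladder.
Variables (F : comNzRingType) (c s : F) (p q : nat).
Let f := rotpoly c s p q.
Let g : {poly F} := c%:P + s%:P * 'X.
Let h : {poly F} := c%:P * 'X - s%:P.
Let A := p%:R * g ^+ p.-1 * h ^+ q.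
Let B := q%:R * g ^+ p * h ^+ q.-1.

Let fA : p%:R * f = A * g.
Proof.
rewrite /f /rotpoly /A -/g -/h; case: (p) => [|k]; first by rewrite !mul0r.
by rewrite exprS /=; ring.
Qed.

Let fB : q%:R * f = B * h.
Proof.
rewrite /f /rotpoly /B -/g -/h; case: (q) => [|k]; first by rewrite !mul0r.
by rewrite exprS /=; ring.
Qed.

Let f'AB : f^`() = A * s%:P + B * c%:P.
Proof.
rewrite /f /rotpoly derivM !deriv_exp /= derivB !derivD !derivM !derivC derivX.
by rewrite -/g -/h /A /B; ring.
Qed.

Let frotAB : rotpoly_deriv c s p q = A * h - B * g.
Proof. by rewrite /rotpoly_deriv /rotpoly -/g -/h /A /B !exprS; ring. Qed.

(** The rotation direction, the dilation X d/dX and the translation d/dX act on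
    f through p/(c + s X) and q/(c X - s) only, so three of them are linearly
    dependent modulo f itself.  It is
    checked on the coefficients of A and B. *)
Lemma ladder_down m :
  c * s * (rotpoly_deriv c s p q)`_m =
  (p%:R * s ^+ 2 - q%:R * c ^+ 2 + m%:R * (c ^+ 2 - s ^+ 2)) * f`_m
  - 2 * c * s * (m.+1%:R * f`_m.+1).
Proof.
have : (c * s)%:P * rotpoly_deriv c s p q =
  (s ^+ 2)%:P * (p%:R * f) - (c ^+ 2)%:P * (q%:R * f)
  + (c ^+ 2 - s ^+ 2)%:P * ('X * f^`()) - (2 * c * s)%:P * f^`().
  rewrite fA fB f'AB frotAB !(polyCM, polyCB, polyC_exp, polyCN) /g /h; ring.
move=> /(congr1 (fun P : {poly F} => P`_m)).
rewrite coefCM !(coefD, coefN, coefB) !coefCM coefXM !mulr_natl !coefMn !coef_deriv => ->.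
rewrite -!(mulr_natl f`_m) -!(mulr_natl f`_m.+1).
case: m => [|m] /=; first by ring.
rewrite -!(mulr_natl f`_m.+1); ring.
Qed.

(** The same dependence with the inverted translation N X - X^2 d/dX, where
    N = p + q, in place of d/dX. *)
Lemma ladder_up m :
  c * s * (rotpoly_deriv c s p q)`_m =
  - (p%:R * s ^+ 2 - q%:R * c ^+ 2 + m%:R * (c ^+ 2 - s ^+ 2)) * f`_m
  + 2 * c * s * (((p + q).+1%:R - m%:R) * ('X * f)`_m).
Proof.
have : (c * s)%:P * rotpoly_deriv c s p q =
  - ((s ^+ 2)%:P * (p%:R * f) - (c ^+ 2)%:P * (q%:R * f))
  - (c ^+ 2 - s ^+ 2)%:P * ('X * f^`()) +
  (2 * c * s)%:P * ('X * ((p + q)%:R * f) - 'X * ('X * f^`())).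
  rewrite (natrD _ p q) (mulrDl p%:R) fA fB f'AB frotAB !(polyCM, polyCB, polyC_exp, polyCN) /g /h polyC_natr.
  by move: A B c%:P s%:P ('X : {poly F}) => a b C S X; ring.
move=> /(congr1 (fun P : {poly F} => P`_m)).
rewrite coefCM !(coefD, coefN, coefB) !coefCM !(coefD, coefN, coefB) !coefXM.
rewrite !mulr_natl !coefMn !coef_deriv => ->.
case: m => [|[|m]] /=; rewrite -?(mulr_natl f`_0) -?(mulr_natl f`_1)
 -?(mulr_natl f`_m) -?(mulr_natl f`_m.+1) -?(mulr_natl f`_m.+2); ring.
Qed.
End Ladder.

(** * Integration by primitives *)

Section FTC.
Context {R : realType}.
Notation mu := (@lebesgue_measure R).

Lemma integrable_segment (f : R -> R) (a b : R) : continuous f ->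
  mu.-integrable `[a, b] (EFin \o f).
Proof.
move=> cf; apply: continuous_compact_integrable; first exact: segment_compact.
exact: continuous_subspaceT.
Qed.

Lemma is_derive_continuous (f f' : R -> R) :
  (forall x : R, is_derive x 1 f (f' x)) -> continuous f.
Proof.
move=> df x; apply: differentiable_continuous; apply/derivable1_diffP.
exact: ex_derive.
Qed.

Lemma integral_is_derive (f f' : R -> R) (a b : R) : a < b -> continuous f' ->
  (forall x : R, is_derive x 1 f (f' x)) ->
  \int[mu]_(x in `[a, b]) f' x = f b - f a.
Proof.
move=> ab cf' df; rewrite /Rintegral (@continuous_FTC2 _ _ f) //.
- exact: continuous_subspaceT.
- have cf := is_derive_continuous df.
  split; first by move=> x _; exact: ex_derive.
    exact/cvg_at_right_filter/cf.
  exact/cvg_at_left_filter/cf.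
- by move=> x _; rewrite derive1E derive_val.
Qed.

Lemma continuous_bigsum (I : Type) (r : seq I) (f : I -> R -> R) :
  (forall i, continuous (f i)) -> continuous (fun x => \sum_(i <- r) f i x).
Proof.
move=> cf; have -> : (fun x => \sum_(i <- r) f i x) = \sum_(i <- r) f i.
  by apply/funext => y; rewrite fct_sumE.
elim/big_ind: _ => [|g h cg ch|i _]; first exact: cst_continuous.
  by move=> x; apply: continuousD; [exact: cg|exact: ch].
exact: cf.
Qed.

Lemma Rintegral_sum (I : Type) (r : seq I) (f : I -> R -> R) (a b : R) :
  (forall i, continuous (f i)) ->
  \int[mu]_(x in `[a, b]) (\sum_(i <- r) f i x) =
  \sum_(i <- r) \int[mu]_(x in `[a, b]) f i x.
Proof.
move=> cf; elim: r => [|i r IH].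
  under eq_Rintegral do rewrite big_nil.
  by rewrite Rintegral_cst//= big_nil mul0r.
under eq_Rintegral do rewrite big_cons.
rewrite big_cons -IH RintegralD//; first exact: integrable_segment.
exact/integrable_segment/continuous_bigsum.
Qed.

Lemma RintegralZ (f : R -> R) (k a b : R) : continuous f ->
  \int[mu]_(x in `[a, b]) (k * f x) = k * \int[mu]_(x in `[a, b]) f x.
Proof. by move=> cf; rewrite RintegralZl//; exact: integrable_segment. Qed.

End FTC.

(** * Derivative in the angle *)

Section PolyDerive.
Context {R : realType}.

Lemma is_derive_exp (f : R -> R) (df x : R) n : is_derive x 1 f df ->
  is_derive x 1 (fun y => f y ^+ n) (n%:R * f x ^+ n.-1 * df).
Proof.
move=> h; have -> : (fun y => f y ^+ n) = f ^+ n.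
  by elim: n => [|n IH]; apply/funext => y; rewrite ?expr0// !exprS -IH.
exact: is_deriveX.
Qed.

(** Differentiability is tested coefficientwise: this gives the product rule
    without a topology on polynomials. *)
Definition is_pderive (x : R) (P : R -> {poly R}) (dP : {poly R}) :=
  forall m, is_derive x 1 (fun y => (P y)`_m) dP`_m.

Lemma is_pderiveM x P Q dP dQ : is_pderive x P dP -> is_pderive x Q dQ ->
  is_pderive x (fun y => P y * Q y) (dP * Q x + P x * dQ).
Proof.
move=> hP hQ m; rewrite coefD.
have -> : (fun y => (P y * Q y)`_m) =
    \sum_(i < m.+1) (fun y => (P y)`_i * (Q y)`_(m - i)).
  by apply/funext => y; rewrite coefM fct_sumE.
rewrite !coefM -big_split /=.
apply: is_derive_sum => i.
have h1 := hP i; have h2 := hQ (m - i)%N.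
have := @is_deriveM _ _ (fun y => (P y)`_i) (fun y => (Q y)`_(m - i)) x 1 _ _ h1 h2.
move=> /is_derive_eq; apply; rewrite /GRing.scale /= addrC; congr (_ + _).
by rewrite mulrC.
Qed.

Lemma is_pderiveX x P dP n : is_pderive x P dP ->
  is_pderive x (fun y => P y ^+ n) (n%:R * (P x ^+ n.-1 * dP)).
Proof.
move=> hP; elim: n => [|n IH].
  by move=> m; rewrite mul0r coef0; exact: (is_derive_cst (1 : {poly R})`_m).
have := is_pderiveM hP IH.
rewrite (_ : (fun y => P y * P y ^+ n) = (fun y => P y ^+ n.+1)); last first.
  by apply/funext => y; rewrite exprS.
move=> H m; apply: (is_derive_eq (H m)); congr (nth _ (polyseq _) _).
by case: n {IH H} => [|n]; rewrite /= ?exprS; ring.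
Qed.

Lemma is_derive_half (x : R) : is_derive x 1 (fun y : R => y / 2) 2^-1.
Proof.
have -> : (fun y : R => y / 2) = 2^-1 \*: id.
  by apply/funext => y /=; rewrite mulrC.
apply: (is_derive_eq (is_deriveZ _ (is_derive_id _ _))).
by rewrite /GRing.scale /= mulr1.
Qed.

Lemma is_derive_cos_half (x : R) : is_derive x 1 (fun y => cos (y / 2)) (- sin (x / 2) / 2).
Proof.
have h := is_derive_half x.
have := @is_derive1_comp _ cos (fun y => y / 2) x _ _ (is_derive_cos _) h.
by [].
Qed.

Lemma is_derive_sin_half (x : R) : is_derive x 1 (fun y => sin (y / 2)) (cos (x / 2) / 2).
Proof.
have h := is_derive_half x.
have := @is_derive1_comp _ sin (fun y => y / 2) x _ _ (is_derive_sin _) h.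
by [].
Qed.

Definition rotang (p q : nat) (b : R) : {poly R} := rotpoly (cos (b / 2)) (sin (b / 2)) p q.

Definition rotang' (p q : nat) (b : R) : {poly R} :=
  2^-1 *: rotpoly_deriv (cos (b / 2)) (sin (b / 2)) p q.

Lemma is_derive_rot p q m (b : R) :
  is_derive b 1 (fun y => (rotang p q y)`_m) (rotang' p q b)`_m.
Proof.
have hg : is_pderive b (fun y => (cos (y / 2))%:P + (sin (y / 2))%:P * 'X)
    (2^-1%:P * ((cos (b / 2))%:P * 'X - (sin (b / 2))%:P)).
  move=> [|[|k]] /=.
  - have -> : (fun y : R => ((cos (y / 2))%:P + (sin (y / 2))%:P * 'X)`_0) = (fun y : R => cos (y / 2)).
      by apply/funext => y; rewrite coefD coefC coefMX addr0.
    apply: (is_derive_eq (is_derive_cos_half b)).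
    by rewrite coefCM coefB coefCM coefX coefC /=; ring.
  - have -> : (fun y : R => ((cos (y / 2))%:P + (sin (y / 2))%:P * 'X)`_1) = (fun y : R => sin (y / 2)).
      by apply/funext => y; rewrite coefD coefC coefMX coefC /= add0r.
    apply: (is_derive_eq (is_derive_sin_half b)).
    by rewrite coefCM coefB coefCM coefX coefC /=; ring.
  - have -> : (fun y : R => ((cos (y / 2))%:P + (sin (y / 2))%:P * 'X)`_k.+2) = cst (0 : R).
      by apply/funext => y; rewrite coefD coefC coefMX coefC /= add0r.
    apply: (is_derive_eq (is_derive_cst _ _ _)).
    by rewrite coefCM coefB coefCM coefX coefC /=; ring.
have hh : is_pderive b (fun y => (cos (y / 2))%:P * 'X - (sin (y / 2))%:P)
    (- 2^-1%:P * ((cos (b / 2))%:P + (sin (b / 2))%:P * 'X)).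
  move=> [|[|k]] /=.
  - have -> : (fun y : R => ((cos (y / 2))%:P * 'X - (sin (y / 2))%:P)`_0) = - (fun y : R => sin (y / 2)).
      by apply/funext => y; rewrite coefB coefC coefMX sub0r.
    apply: (is_derive_eq (is_deriveN (is_derive_sin_half b))).
    by rewrite [in RHS]mulNr coefN coefCM coefD coefCM coefX coefC /=; ring.
  - have -> : (fun y : R => ((cos (y / 2))%:P * 'X - (sin (y / 2))%:P)`_1) = (fun y : R => cos (y / 2)).
      by apply/funext => y; rewrite coefB coefC coefMX coefC /= subr0.
    apply: (is_derive_eq (is_derive_cos_half b)).
    by rewrite [in RHS]mulNr coefN coefCM coefD coefCM coefX coefC /=; ring.
  - have -> : (fun y : R => ((cos (y / 2))%:P * 'X - (sin (y / 2))%:P)`_k.+2) = cst (0 : R).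
      by apply/funext => y; rewrite coefB coefC coefMX coefC /= subr0.
    apply: (is_derive_eq (is_derive_cst _ _ _)).
    by rewrite [in RHS]mulNr coefN coefCM coefD coefCM coefX coefC /=; ring.
have := is_pderiveM (is_pderiveX p hg) (is_pderiveX q hh).
move=> H; apply: (is_derive_eq (H m)); congr (nth _ (polyseq _) _).
rewrite /rotang' /rotpoly_deriv /rotpoly -mul_polyC !exprS.
move: (_ + _) (_ - _) => g h.
ring.
Qed.

End PolyDerive.

(** * Ladder relations *)

Section RotLadder.
Context {R : realType}.
Implicit Types (p q m : nat) (b : R).

Lemma sin_half b : sin b = 2 * cos (b / 2) * sin (b / 2).
Proof. by rewrite {1}(splitr b) sinD; ring. Qed.

Lemma cos_half b : cos b = cos (b / 2) ^+ 2 - sin (b / 2) ^+ 2.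
Proof. by rewrite {1}(splitr b) cosD; ring. Qed.

(** In terms of the orders k = n - m and j of a Wigner function of degree n, this
    is j - k cos b, where 2n = p + q and 2j = p - q. *)
Definition ladder_coef p q m b : R :=
  (p%:R + q%:R) / 2 - q%:R + (m%:R - (p%:R + q%:R) / 2) * cos b.

Let coefE p q m b : p%:R * sin (b / 2) ^+ 2 - q%:R * cos (b / 2) ^+ 2 +
  m%:R * (cos (b / 2) ^+ 2 - sin (b / 2) ^+ 2) = ladder_coef p q m b.
Proof.
rewrite /ladder_coef (cos_half b); have := cos2Dsin2 (b / 2).
move: (cos (b / 2)) (sin (b / 2)) => c s h.
have -> : (p%:R + q%:R) / 2 - q%:R = ((p%:R - q%:R) / 2) * (c ^+ 2 + s ^+ 2) :> R.
  by rewrite h mulr1; field.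
by field.
Qed.

Lemma rot_ladder_down p q m b : sin b * (rotang' p q b)`_m =
  ladder_coef p q m b * (rotang p q b)`_m - sin b * (m.+1%:R * (rotang p q b)`_m.+1).
Proof.
rewrite /rotang' coefZ (sin_half b) -coefE -(ladder_down) /rotang.
by field.
Qed.

Lemma rot_ladder_up p q m b : sin b * (rotang' p q b)`_m =
  - ladder_coef p q m b * (rotang p q b)`_m +
  sin b * (((p + q).+1%:R - m%:R) * ('X * rotang p q b)`_m).
Proof.
rewrite /rotang' coefZ (sin_half b) -coefE -(ladder_up) /rotang.
by field.
Qed.

Lemma continuous_rot p q m : continuous (fun b => (rotang p q b)`_m).
Proof. exact: is_derive_continuous (is_derive_rot p q m). Qed.

Lemma continuous_Xrot p q m : continuous (fun b => ('X * rotang p q b)`_m).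
Proof.
have -> : (fun b => ('X * rotang p q b)`_m) =
          (if m == 0%N then cst 0 else fun b => (rotang p q b)`_m.-1).
  by apply/funext => b; rewrite coefXM; case: m.
case: m => [|m] /=; [exact: cst_continuous|exact: continuous_rot].
Qed.

End RotLadder.

(** * Orthogonality of the Wigner functions *)

Section Orthogonality.
Context {R : realType}.
Notation mu := (@lebesgue_measure R).
Implicit Types (p q m : nat) (b : R).

(** The derivative of sin b times a product of coefficients whose orders differ
    by one: raising the first factor and lowering the second makes the terms
    without sine cancel, and the boundary values vanish. *)
Lemma rot_ladder_integral p1 q1 m1 p2 q2 m2 :
  (m1 + p2 = (m2 + p1).+1)%N -> (p1 + q2 = p2 + q1)%N ->
  ((p1 + q1).+1%:R - m1%:R) * \int[mu]_(b in `[0, pi])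
     (('X * rotang p1 q1 b)`_m1 * (rotang p2 q2 b)`_m2 * sin b) =
  m2.+1%:R * \int[mu]_(b in `[0, pi])
     ((rotang p1 q1 b)`_m1 * (rotang p2 q2 b)`_m2.+1 * sin b).
Proof.
move=> hm hpq; apply/eqP; rewrite -subr_eq0; apply/eqP.
have c1 : continuous (fun b => ('X * rotang p1 q1 b)`_m1 * (rotang p2 q2 b)`_m2 * sin b).
  by move=> b; apply: cvgM; [apply: cvgM; [exact: continuous_Xrot|exact: continuous_rot]|exact: continuous_sin].
have c2 : continuous (fun b => (rotang p1 q1 b)`_m1 * (rotang p2 q2 b)`_m2.+1 * sin b).
  by move=> b; apply: cvgM; [apply: cvgM; exact: continuous_rot|exact: continuous_sin].
rewrite -!RintegralZ// -RintegralB//; last 2 first.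
- by apply: integrable_segment => b; apply: cvgM; [exact: cvg_cst|exact: c1].
- by apply: integrable_segment => b; apply: cvgM; [exact: cvg_cst|exact: c2].
have dF b : is_derive b 1 (fun b => sin b * ((rotang p1 q1 b)`_m1 * (rotang p2 q2 b)`_m2))
  (((p1 + q1).+1%:R - m1%:R) * (('X * rotang p1 q1 b)`_m1 * (rotang p2 q2 b)`_m2 * sin b) -
   m2.+1%:R * ((rotang p1 q1 b)`_m1 * (rotang p2 q2 b)`_m2.+1 * sin b)).
  have := is_deriveM (is_derive_sin b)
    (is_deriveM (is_derive_rot p1 q1 m1 b) (is_derive_rot p2 q2 m2 b)).
  move=> /is_derive_eq; apply; rewrite /GRing.scale /= fctE.
  rewrite [X in _ = X](_ : _ =
     (sin b * (((p1 + q1).+1%:R - m1%:R) * ('X * rotang p1 q1 b)`_m1)) * (rotang p2 q2 b)`_m2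
   - (rotang p1 q1 b)`_m1 * (sin b * (m2.+1%:R * (rotang p2 q2 b)`_m2.+1))); last by ring.
  have -> : sin b * (((p1 + q1).+1%:R - m1%:R) * ('X * rotang p1 q1 b)`_m1) =
    sin b * (rotang' p1 q1 b)`_m1 + ladder_coef p1 q1 m1 b * (rotang p1 q1 b)`_m1.
    by rewrite rot_ladder_up; ring.
  have -> : sin b * (m2.+1%:R * (rotang p2 q2 b)`_m2.+1) =
     ladder_coef p2 q2 m2 b * (rotang p2 q2 b)`_m2 - sin b * (rotang' p2 q2 b)`_m2.
    by rewrite rot_ladder_down; ring.
  have -> : ladder_coef p1 q1 m1 b = ladder_coef p2 q2 m2 b + cos b.
    rewrite /ladder_coef.
    have h1 : m1%:R + p2%:R = m2%:R + p1%:R + 1 :> R by rewrite -!natrD hm -natr1.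
    have h2 : p1%:R + q2%:R = p2%:R + q1%:R :> R by rewrite -!natrD hpq.
    have -> : m1%:R = m2%:R + p1%:R + 1 - p2%:R :> R by lra.
    have -> : q2%:R = p2%:R + q1%:R - p1%:R :> R by lra.
    by field.
  ring.
rewrite (@integral_is_derive _ _ _ _ _ (pi_gt0 R) _ dF).
  by rewrite sinpi sin0 !mul0r subrr.
by move=> b; apply: cvgB; apply: cvgM; [exact: cvg_cst|exact: c1|exact: cvg_cst|exact: c2].
Qed.

(** Passing from m to m + 1 multiplies the integral by a constant, and at m = 0
    the shorter ladder has ended while the longer one has not, which forces the
    integral to vanish. *)
Lemma rot_orthogonal p q m d : (0 < d)%N ->
  \int[mu]_(b in `[0, pi]) ((rotang p q b)`_m * (rotang (p + d) (q + d) b)`_(m + d) * sin b) = 0.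
Proof.
case: d => // d _.
have hpq : (p + (q + d.+1) = p + d.+1 + q)%N by lia.
elim: m => [|m IH].
  have hm : (0 + (p + d.+1) = (d + p).+1)%N by lia.
  have := rot_ladder_integral hm hpq.
  rewrite (@eq_Rintegral _ _ _ mu _ (fun=> 0)); last by move=> b _; rewrite coefXM !mul0r.
  rewrite Rintegral_cst//= mul0r mulr0 => /esym/eqP.
  by rewrite mulf_eq0 pnatr_eq0 /= => /eqP.
have hm : (m.+1 + (p + d.+1) = (m + d.+1 + p).+1)%N by lia.
have := rot_ladder_integral hm hpq.
rewrite (@eq_Rintegral _ _ _ mu _ (fun b => (rotang p q b)`_m * (rotang (p + d.+1) (q + d.+1) b)`_(m + d.+1) * sin b)); last first.
  by move=> b _; rewrite coefXM.
by rewrite IH mulr0 => /esym/eqP; rewrite mulf_eq0 pnatr_eq0 /= => /eqP.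
Qed.

(** In equal degrees the same recurrence is that of the binomial coefficients. *)
Lemma rot_norm_binomial p q m :
  \int[mu]_(b in `[0, pi]) ((rotang p q b)`_m ^+ 2 * sin b) =
  'C(p + q, m)%:R * \int[mu]_(b in `[0, pi]) ((rotang p q b)`_0 ^+ 2 * sin b).
Proof.
elim: m => [|m IH]; first by rewrite bin0 mul1r.
have hm : (m.+1 + p = (m + p).+1)%N by [].
have h := rot_ladder_integral hm (erefl (p + q)%N).
apply: (@mulfI _ m.+1%:R); first by rewrite pnatr_eq0.
rewrite [RHS]mulrA -natrM mul_bin_left natrM -mulrA.
under eq_Rintegral do rewrite expr2.
rewrite -h.
under eq_Rintegral do rewrite coefXM /= -expr2.
rewrite IH.
have -> : (p + q).+1%:R - m.+1%:R = (p + q)%:R - m%:R :> R by rewrite -!natr1; ring.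
have [le|lt] := leqP m (p + q).
  by rewrite natrB//; ring.
by rewrite bin_small// !(mul0r, mulr0).
Qed.

(** The constant coefficient is c^p s^q up to sign, so this is a Beta integral in
    the variable s^2. *)
Lemma rot_beta p q :
  \int[mu]_(b in `[0, pi]) ((rotang p q b)`_0 ^+ 2 * sin b) =
  2 * p`!%:R * q`!%:R / (p + q).+1`!%:R.
Proof.
pose B p q := \int[mu]_(b in `[0, pi]) (cos (b / 2) ^+ (2 * p) * sin (b / 2) ^+ (2 * q) * sin b).
have -> : \int[mu]_(b in `[0, pi]) ((rotang p q b)`_0 ^+ 2 * sin b) = B p q.
  apply: eq_Rintegral => b _; rewrite /rotang /rotpoly -horner_coef0.
  rewrite hornerM !horner_exp !hornerE.
  by rewrite exprMn -!exprM ![(_ * 2)%N]mulnC (exprM (- _)) sqrrN -exprM.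
have cC : continuous (fun b : R => cos (b / 2)) := is_derive_continuous is_derive_cos_half.
have cS : continuous (fun b : R => sin (b / 2)) := is_derive_continuous is_derive_sin_half.
have cX (f : R -> R) n : continuous f -> continuous (fun b : R => f b ^+ n).
  move=> cf b; apply: (@continuous_comp _ _ _ f (fun x => x ^+ n)); first exact: cf.
  exact: exprn_continuous.
have cB k l : continuous (fun b : R => cos (b / 2) ^+ (2 * k) * sin (b / 2) ^+ (2 * l) * sin b).
  by move=> b; apply: cvgM; [apply: cvgM; apply: cX|exact: continuous_sin].
have deriv k l b : is_derive b 1 (fun b : R => cos (b / 2) ^+ (2 * k) * sin (b / 2) ^+ (2 * l))
   ((l%:R * (cos (b / 2) ^+ (2 * k) * sin (b / 2) ^+ (2 * l.-1) * sin b) -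
    k%:R * (cos (b / 2) ^+ (2 * k.-1) * sin (b / 2) ^+ (2 * l) * sin b)) / 2).
  have h1 := is_derive_exp (2 * k) (is_derive_cos_half b).
  have h2 := is_derive_exp (2 * l) (is_derive_sin_half b).
  apply: (is_derive_eq (is_deriveM h1 h2)).
  rewrite /GRing.scale /= !(sin_half b).
  have e2 i : (2 * i.+1 = (2 * i).+2)%N by rewrite mulnS.
  case: k l {h1 h2} => [|k] [|l]; rewrite ?e2 ?muln0.
  - by field.
  - by rewrite -[l.+1.-1]/l -[_.+2.-1]/(2 * l).+1 !exprS -(e2 l) natrM; field.
  - by rewrite -[k.+1.-1]/k -[_.+2.-1]/(2 * k).+1 !exprS -(e2 k) natrM; field.
  - rewrite -[l.+1.-1]/l -[k.+1.-1]/k -[(2 * l).+2.-1]/(2 * l).+1.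
    by rewrite -[(2 * k).+2.-1]/(2 * k).+1 !exprS -(e2 l) -(e2 k) !natrM; field.
have B0 k : B k 0 = 2 / k.+1%:R.
  have dF b : is_derive b 1 (fun b : R => - (2 / k.+1%:R) * (cos (b / 2) ^+ (2 * k.+1)))
     (cos (b / 2) ^+ (2 * k) * sin (b / 2) ^+ (2 * 0) * sin b).
    have h1 := is_derive_exp (2 * k.+1) (is_derive_cos_half b).
    have e2 : (2 * k.+1 = (2 * k).+2)%N by rewrite mulnS.
    rewrite [X in (_%:R * _ ^+ X.-1)]e2 -[_.+2.-1]/(2 * k).+1 in h1.
    apply: (is_derive_eq (is_deriveZ (- (2 / k.+1%:R)) h1)).
    rewrite /GRing.scale /= (sin_half b) muln0 expr0 mulr1 natrM.
    by rewrite exprS -(@natr1 _ k); field; rewrite natr1 pnatr_eq0.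
  rewrite /B (integral_is_derive (pi_gt0 R) (cB k 0) dF).
  rewrite mul0r cos0 expr1n cos_pihalf mulnS !exprS; ring.
have BS k l : (k + l).+2%:R * B k l.+1 = l.+1%:R * B k l.
  have dF b : is_derive b 1 (fun b : R => 2 * (cos (b / 2) ^+ (2 * k.+1) * sin (b / 2) ^+ (2 * l.+1)))
     (l.+1%:R * (cos (b / 2) ^+ (2 * k) * sin (b / 2) ^+ (2 * l) * sin b) -
      (k + l).+2%:R * (cos (b / 2) ^+ (2 * k) * sin (b / 2) ^+ (2 * l.+1) * sin b)).
    apply: (is_derive_eq (is_deriveZ 2 (deriv k.+1 l.+1 b))).
    have -> : (k + l).+2%:R = k.+1%:R + l.+1%:R :> R by rewrite -natrD; congr (_%:R); lia.
    have e (x : R) i : x ^+ (2 * i.+1) = x ^+ 2 * x ^+ (2 * i) by rewrite -exprD mulnS.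
    rewrite /GRing.scale /= !e.
    have := cos2Dsin2 (b / 2); move: (cos (b / 2)) (sin (b / 2)) => c s h.
    have -> : c ^+ 2 = 1 - s ^+ 2 by rewrite -h addrK.
    by field.
  have := integral_is_derive (pi_gt0 R) _ dF.
  rewrite RintegralB//; last 2 first.
  - by apply: integrable_segment => b; apply: cvgM; [exact: cvg_cst|exact: cB].
  - by apply: integrable_segment => b; apply: cvgM; [exact: cvg_cst|exact: cB].
  rewrite !RintegralZ// mul0r sin0 cos_pihalf !expr0n !muln_eq0 /= !(mul0r, mulr0) subr0 => H.
  apply/esym/eqP; rewrite -subr_eq0; apply/eqP/H.
  by move=> b; apply: cvgB; apply: cvgM; [exact: cvg_cst|exact: cB|exact: cvg_cst|exact: cB].
elim: q => [|q IH].
  rewrite B0 addn0 fact0 mulr1 factS natrM; field.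
  by rewrite nat1r !pnatr_eq0 -!lt0n fact_gt0.
apply: (@mulfI _ (p + q).+2%:R); first by rewrite pnatr_eq0.
rewrite BS IH addnS (factS q) (factS (p + q).+1) (natrM _ q.+1 q`!) (natrM _ (p + q).+2 (p + q).+1`!).
have : (p + q).+1`!%:R != 0 :> R by rewrite pnatr_eq0 -lt0n fact_gt0.
have : (p + q).+2%:R != 0 :> R by rewrite pnatr_eq0.
move: ((p + q).+2%:R) ((p + q).+1`!%:R) => x y hx hy. by field; rewrite hx hy.
Qed.
End Orthogonality.

(** * Fractional substitutions in powers of a quadratic polynomial *)

Section Homogenize.
Variable F : comNzRingType.
Implicit Types (P g h : {poly F}) (a b d : F).

(** P evaluated at h / g, multiplied by g^N; meaningful for P of degree at most
    N. *)
Definition homogenize (N : nat) P g h : {poly F} :=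
  \sum_(m < N.+1) P`_m *: (h ^+ m * g ^+ (N - m)).

Lemma homogenizeD N P Q g h :
  homogenize N (P + Q) g h = homogenize N P g h + homogenize N Q g h.
Proof. by rewrite -big_split; apply: eq_bigr => m _; rewrite coefD scalerDl. Qed.

Lemma homogenizeC N a P g h : homogenize N (a%:P * P) g h = a%:P * homogenize N P g h.
Proof.
rewrite [RHS]mulr_sumr; apply: eq_bigr => m _.
by rewrite coefCM mul_polyC scalerA.
Qed.

Lemma homogenizeX N P g h : homogenize N.+1 ('X * P) g h = h * homogenize N P g h.
Proof.
rewrite /homogenize big_ord_recl coefXM scale0r add0r mulr_sumr.
apply: eq_bigr => m _; rewrite coefXM lift0 /= subSS.
by rewrite -scalerAr mulrA -exprS.
Qed.

Lemma homogenizeS N P g h : (size P <= N.+1)%N ->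
  homogenize N.+1 P g h = g * homogenize N P g h.
Proof.
move=> sP; rewrite /homogenize big_ord_recr /= (nth_default _ sP) scale0r addr0 mulr_sumr.
apply: eq_bigr => m _; rewrite subSn ?exprS; last by rewrite -ltnS ltn_ord.
by rewrite -scalerAr; congr (_ *: _); rewrite mulrCA.
Qed.

Lemma size_quadratic_exp a b d n :
  (size ((a%:P * 'X^2 + b%:P * 'X + d%:P) ^+ n)%R <= (2 * n).+1)%N.
Proof.
apply: leq_trans (size_poly_exp_leq _ _) _; rewrite ltnS leq_mul2r.
apply/orP; right.
have -> : a%:P * 'X^2 + b%:P * 'X + d%:P = Poly [:: d; b; a].
  by rewrite /= !cons_poly_def mul0r add0r; ring.
by move: (size_Poly [:: d; b; a]); case: (size _).
Qed.

(** Substitution of h / g is multiplicative once denominators are cleared. *)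
Lemma homogenize_quadratic a b d g h n :
  (a%:P * h ^+ 2 + b%:P * (h * g) + d%:P * g ^+ 2) ^+ n =
  homogenize (2 * n) ((a%:P * 'X^2 + b%:P * 'X + d%:P) ^+ n) g h.
Proof.
elim: n => [|n IH].
  by rewrite muln0 !expr0 /homogenize big_ord1 coefC /= mulr1 scale1r.
have sP := size_quadratic_exp a b d n.
rewrite !(exprS _ n) IH mulnS.
move: (_ ^+ n) sP => P sP.
rewrite [_ * P]mulrDl [_ * P]mulrDl !homogenizeD -!mulrA !homogenizeC.
rewrite -[(2 + 2 * n)%N]/(2 * n).+2 !homogenizeX !homogenizeS//; last exact: leq_trans sP _.
by ring.
Qed.

End Homogenize.

Section CoefSymmetry.
Variable F : comNzRingType.

Lemma rotpoly_diag (c s : F) n :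
  rotpoly c s n n = ((c * s)%:P * 'X^2 + (c ^+ 2 - s ^+ 2)%:P * 'X + (- (c * s))%:P) ^+ n.
Proof.
by rewrite /rotpoly -exprMn; congr (_ ^+ _); rewrite !(polyCM, polyCB, polyCN) ?polyC_exp; ring.
Qed.

(** The quadratic polynomial (c + s X)(c X - s) changes sign under X -> -1/X,
    once multiplied by X^2. *)
Lemma rotpoly_sym (c s : F) n m : (m <= 2 * n)%N ->
  (rotpoly c s n n)`_(2 * n - m) = (-1) ^+ (n + m) * (rotpoly c s n n)`_m.
Proof.
move=> lem; rewrite rotpoly_diag.
set a := c * s; set b := c ^+ 2 - s ^+ 2; set Q := _ + _ + _.
have := homogenize_quadratic a b (- a) 'X (-1) n.
have -> : a%:P * (-1) ^+ 2 + b%:P * ((-1) * 'X) + (- a)%:P * 'X ^+ 2 = - Q.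
  by rewrite /Q polyCN; ring.
rewrite -/Q => /(congr1 (fun P : {poly F} => P`_(2 * n - m))).
rewrite (exprNn Q).
have -> : (-1 : {poly F}) ^+ n = ((-1) ^+ n)%:P by rewrite rmorphXn /= polyCN.
(* Only the term of index m contributes in degree 2n - m. *)
rewrite coefCM coef_sum (bigD1 (inord m)) //= big1 => [|i ne]; last first.
  rewrite coefZ (_ : (-1) ^+ i = ((-1) ^+ i)%:P); last by rewrite rmorphXn /= polyCN.
  rewrite coefCM coefXn; case: eqP => [e|_]; last by rewrite !mulr0.
  case/eqP: ne; apply/val_inj; rewrite /= inordK ?ltnS//.
  by have := ltn_ord i; lia.
rewrite inordK ?ltnS// addr0 coefZ (_ : (-1) ^+ m = ((-1) ^+ m)%:P); last by rewrite rmorphXn /= polyCN.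
rewrite coefCM coefXn eqxx mulr1 => h.
by rewrite exprD -mulrA [_ ^+ m * _]mulrC -h mulrA -exprD addnn -mul2n exprM sqrrN !expr1n mul1r.
Qed.

End CoefSymmetry.

(** * Integrals over a meridian *)

Section SphereIntegral.
Context {R : realType}.
Notation mu := (@lebesgue_measure R).

(** Up to a constant, the integral over [-1, 1] of the associated Legendre
    function of degree n and order n - m. *)
Definition meridian (n m : nat) : R :=
  \int[mu]_(b in `[0, pi]) ((rotang n n b)`_m * sin b).

Lemma meridian_sym n m : (m <= 2 * n)%N ->
  meridian n (2 * n - m) = (-1) ^+ (n + m) * meridian n m.
Proof.
move=> lem; rewrite /meridian -RintegralZ.
  by apply: eq_Rintegral => b _; rewrite /rotang rotpoly_sym// mulrA.
by move=> b; apply: cvgM; [exact: continuous_rot|exact: continuous_sin].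
Qed.

Lemma continuous_scale (k : R) (f : R -> R) :
  continuous f -> continuous (fun b : R => k * f b).
Proof. by move=> cf b; apply: cvgM; [exact: cvg_cst|exact: cf]. Qed.

Lemma continuous_lincomb (k l : R) (f g : R -> R) : continuous f -> continuous g ->
  continuous (fun b : R => k * f b - l * g b).
Proof.
by move=> cf cg b; apply: cvgB; apply: cvgM; [exact: cvg_cst|exact: cf|exact: cvg_cst|exact: cg].
Qed.

(** Integrating the two ladder relations by parts expresses the neighbours m + 1
    and m - 1 through the same integral C of the m-th coefficient against the
    cosine. *)
Lemma meridian_ladder n m :
  m.+1%:R * (n%:R + 1 - m%:R) * meridian n m.+1 =
  ((2 * n).+1%:R - m%:R) * (n%:R - 1 - m%:R) *
    \int[mu]_(b in `[0, pi]) (('X * rotang n n b)`_m * sin b).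
Proof.
pose C := \int[mu]_(b in `[0, pi]) (cos b * (rotang n n b)`_m).
have cC : continuous (fun b : R => cos b * (rotang n n b)`_m).
  by move=> b; apply: cvgM; [exact: continuous_cos|exact: continuous_rot].
have c1 : continuous (fun b : R => (rotang n n b)`_m.+1 * sin b).
  by move=> b; apply: cvgM; [exact: continuous_rot|exact: continuous_sin].
have c2 : continuous (fun b : R => ('X * rotang n n b)`_m * sin b).
  by move=> b; apply: cvgM; [exact: continuous_Xrot|exact: continuous_sin].
have cE (b : R) : ladder_coef n n m b = (m%:R - n%:R) * cos b by rewrite /ladder_coef; field.
have down : (m%:R - n%:R + 1) * C = m.+1%:R * meridian n m.+1.
  have dF (b : R) : is_derive b 1 (fun b : R => sin b * (rotang n n b)`_m)
     ((m%:R - n%:R + 1) * (cos b * (rotang n n b)`_m) - m.+1%:R * ((rotang n n b)`_m.+1 * sin b)).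
    apply: (is_derive_eq (is_deriveM (is_derive_sin b) (is_derive_rot n n m b))).
    by rewrite /GRing.scale /= rot_ladder_down cE; ring.
  have := integral_is_derive (pi_gt0 R) _ dF.
  rewrite sinpi sin0 !mul0r subrr RintegralB//; last 2 first.
  - exact/integrable_segment/continuous_scale.
  - exact/integrable_segment/continuous_scale.
  rewrite !RintegralZ// => H; apply/eqP; rewrite -subr_eq0; apply/eqP/H.
  exact: continuous_lincomb.
have up : (m%:R - n%:R - 1) * C = ((2 * n).+1%:R - m%:R) *
    \int[mu]_(b in `[0, pi]) (('X * rotang n n b)`_m * sin b).
  have dF (b : R) : is_derive b 1 (fun b : R => sin b * (rotang n n b)`_m)
     (((2 * n).+1%:R - m%:R) * (('X * rotang n n b)`_m * sin b) -
      (m%:R - n%:R - 1) * (cos b * (rotang n n b)`_m)).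
    apply: (is_derive_eq (is_deriveM (is_derive_sin b) (is_derive_rot n n m b))).
    by rewrite /GRing.scale /= rot_ladder_up cE addnn -mul2n; ring.
  have := integral_is_derive (pi_gt0 R) _ dF.
  rewrite sinpi sin0 !mul0r subrr RintegralB//; last 2 first.
  - exact/integrable_segment/continuous_scale.
  - exact/integrable_segment/continuous_scale.
  rewrite !RintegralZ// => H; apply/esym/eqP; rewrite -subr_eq0; apply/eqP/H.
  exact: continuous_lincomb.
rewrite mulrAC -down [in RHS]mulrAC -up; ring.
Qed.

(** The Wallis integrals, in the normalisation in which lambda is written: the
    parity of n decides between the starting values pi and 2. *)
Lemma wallis n : \int[mu]_(b in `[0, pi]) (sin b ^+ n.+1) =
  (dfact n)%:R / (dfact n.+1)%:R * (if odd n then pi else 2).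
Proof.
have cS k : continuous (fun b : R => sin b ^+ k).
  move=> b; apply: (@continuous_comp _ _ _ sin (fun x => x ^+ k)); first exact: continuous_sin.
  exact: exprn_continuous.
have rec k : k.+2%:R * \int[mu]_(b in `[0, pi]) (sin b ^+ k.+2) =
    k.+1%:R * \int[mu]_(b in `[0, pi]) (sin b ^+ k).
  have dF (b : R) : is_derive b 1 (fun b : R => sin b ^+ k.+1 * cos b)
     (k.+1%:R * sin b ^+ k - k.+2%:R * sin b ^+ k.+2).
    apply: (is_derive_eq (is_deriveM (is_derive_exp k.+1 (is_derive_sin b)) (is_derive_cos b))).
    rewrite /GRing.scale /= !exprS -(@natr1 _ k.+1).
    have := cos2Dsin2 b; move: (cos b) (sin b) => c s h.
    have -> : c * (k.+1%:R * s ^+ k * c) = k.+1%:R * s ^+ k * c ^+ 2 by ring.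
    have -> : c ^+ 2 = 1 - s ^+ 2 by rewrite -h addrK.
    ring.
  have := integral_is_derive (pi_gt0 R) _ dF.
  rewrite RintegralB//; last 2 first.
  - exact/integrable_segment/continuous_scale.
  - exact/integrable_segment/continuous_scale.
  rewrite !RintegralZ// sinpi sin0 !exprS !mul0r subrr => H.
  apply/esym/eqP; rewrite -subr_eq0; apply/eqP/H.
  exact: continuous_lincomb.
have W0 : \int[mu]_(b in `[0, pi]) (sin b ^+ 0) = pi :> R.
  under eq_Rintegral do rewrite expr0.
  rewrite Rintegral_cst//= lebesgue_measure_itv /= lte_fin pi_gt0 /= subr0.
  by rewrite mul1r.
have W1 : \int[mu]_(b in `[0, pi]) (sin b ^+ 1) = 2 :> R.
  under eq_Rintegral do rewrite expr1.
  have dF (b : R) : is_derive b 1 (fun b : R => - cos b) (sin b).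
    by apply: (is_derive_eq (is_deriveN (is_derive_cos b))); rewrite opprK.
  by rewrite (integral_is_derive (pi_gt0 R) _ dF)//; [rewrite cospi cos0; ring|exact: continuous_sin].
have dS k : dfact k.+2 = (k.+2 * dfact k)%N by [].
have d0 k : (dfact k)%:R != 0 :> R.
  rewrite pnatr_eq0; have [l] := ubnP k; elim: l k => // l IH [|[|k]] // lk.
  by rewrite dS muln_eq0 /=; apply: IH; lia.
have [l] := ubnP n; elim: l n => // l IH [|[|n]] // lk.
- by rewrite W1 /= divr1 mul1r.
- apply: (@mulfI _ 2); first by rewrite pnatr_eq0.
  by rewrite rec W0 /=; field.
- apply: (@mulfI _ n.+3%:R); first by rewrite pnatr_eq0.
  rewrite rec IH; last by lia.
  rewrite (dS n) (dS n.+1) (natrM _ n.+2) (natrM _ n.+3) /= negbK.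
  have := d0 n.+1; have : n.+3%:R != 0 :> R by rewrite pnatr_eq0.
  move: (n.+3%:R) ((dfact n.+1)%:R) ((dfact n)%:R) => x y z hx hy.
  by field; rewrite hx hy.
Qed.

End SphereIntegral.

(** * Convolutions of central binomial coefficients *)

Section CentralBinomial.
Context {R : realType}.

(** The power series coefficients of (1 - x)^(-1/2). *)
Definition central (a : nat) : R := 'C(2 * a, a)%:R / 4 ^+ a.

Lemma centralS a : a.+1%:R * central a.+1 = (a%:R + 2^-1) * central a.
Proof.
have key : (a.+1 * 'C(2 * a.+1, a.+1) = 2 * (2 * a).+1 * 'C(2 * a, a))%N.
  rewrite (_ : 2 * a.+1 = (2 * a).+2)%N; last by rewrite mulnS.
  have h1 := mul_bin_diag (2 * a).+2 a; have h2 := mul_bin_down (2 * a).+1 a.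
  rewrite /= in h1 h2; rewrite -h1.
  have e : ((2 * a).+1 - a = a.+1)%N by lia.
  rewrite e in h2; move: h2; move: 'C(_, _) 'C(_, _) => x y; lia.
rewrite /central exprS (mulrA a.+1%:R) -natrM key !natrM -(@natr1 _ (2 * a)) natrM.
by field; rewrite expf_neq0// pnatr_eq0.
Qed.

Lemma sum_antidiagonal_rev m (f : nat -> nat -> R) :
  \sum_(a < m.+1) f a (m - a)%N = \sum_(a < m.+1) f (m - a)%N a.
Proof.
rewrite (reindex_inj rev_ord_inj) /=; apply: eq_bigr => a _.
by rewrite subSS subKn// leq_ord.
Qed.

(** The square of (1 - x)^(-1/2) is the geometric series.  In terms of
    coefficients: by symmetry the first moment T m is m/2 times the sum S m, and
    their recurrence gives T (m + 1) = T m + S m / 2. *)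
Lemma central_sum n : \sum_(a < n.+1) central a * central (n - a) = 1.
Proof.
pose S m := \sum_(a < m.+1) central a * central (m - a).
pose T m := \sum_(a < m.+1) a%:R * central a * central (m - a).
have TS m : 2 * T m = m%:R * S m.
  rewrite mulr2n mulrDl !mul1r {2}/T.
  rewrite (sum_antidiagonal_rev m (fun a b => a%:R * central a * central b)).
  rewrite -big_split mulr_sumr /=; apply: eq_bigr => a _.
  by rewrite natrB ?leq_ord//; ring.
have T1 m : T m.+1 = T m + 2^-1 * S m.
  rewrite /T big_ord_recl /= !mul0r add0r mulr_sumr -big_split /=.
  apply: eq_bigr => a _; rewrite /bump /= add1n subSS centralS; ring.
change (S n = 1); elim: n => [|n IH].
  by rewrite /S big_ord1 /central /= !expr0 !divr1 mulr1.
apply: (@mulfI _ n.+1%:R); first by rewrite pnatr_eq0.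
by rewrite -TS T1 mulrDr TS mulrA divff ?mul1r ?pnatr_eq0// IH !mulr1 natr1.
Qed.

(** Since (n - 2a)^2 = n^2 - 4 a (n - a), only the mixed moment U is needed; it
    obeys the same kind of recurrence as the first moment. *)
Lemma central_second_moment n :
  \sum_(a < n.+1) (n%:R - 2 * a%:R) ^+ 2 * (central a * central (n - a)) =
  n%:R * n.+1%:R / 2.
Proof.
pose U m := \sum_(a < m.+1) a%:R * (m - a)%:R * central a * central (m - a).
pose T m := \sum_(a < m.+1) (m - a)%:R * central a * central (m - a).
have TE m : T m = m%:R / 2.
  have : T m + T m = m%:R.
    rewrite {2}/T (sum_antidiagonal_rev m (fun a b => b%:R * central a * central b)).
    rewrite -big_split -[in RHS](mulr1 m%:R) -[X in _ * X](central_sum m) mulr_sumr /=; apply: eq_bigr => a _.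
    by rewrite natrB ?leq_ord//; ring.
  by move=> <-; field.
have US m : U m.+1 = U m + 2^-1 * T m.
  rewrite /U big_ord_recl /= !mul0r add0r mulr_sumr -big_split /=.
  apply: eq_bigr => a _; rewrite /bump /= add1n subSS.
  by rewrite (mulrAC _ (m - a)%:R) centralS; ring.
have UE m : U m = m%:R * (m%:R - 1) / 8.
  elim: m => [|m IH]; first by rewrite /U big_ord1 !mul0r.
  by rewrite US IH TE -natr1; field.
have -> : \sum_(a < n.+1) (n%:R - 2 * a%:R) ^+ 2 * (central a * central (n - a)) =
   n%:R ^+ 2 * \sum_(a < n.+1) central a * central (n - a) - 4 * U n.
  rewrite !mulr_sumr -sumrB /=; apply: eq_bigr => a _.
  by rewrite natrB ?leq_ord//; ring.
by rewrite central_sum UE -natr1; field.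
Qed.
End CentralBinomial.

(** * Closed form and size of the meridian integrals *)

Section Meridian.
Context {R : realType}.

Lemma dfact_gt0 n : (0 < dfact n)%N.
Proof.
have [k] := ubnP n; elim: k n => // k IH [|[|n]] // hn.
by rewrite /= muln_gt0 /= IH//; lia.
Qed.

Lemma dfactE n : (0 < n)%N -> dfact n = (n * dfact (n - 2))%N.
Proof. by case: n => [|[|n]] // _; rewrite !subSS subn0. Qed.

(** The constant coefficient of f(n, n, b) is (- sin b / 2)^n. *)
Lemma meridian0 n : meridian n 0 = (- 2^-1) ^+ n *
  ((dfact n)%:R / (dfact n.+1)%:R * (if odd n then pi else 2)) :> R.
Proof.
rewrite -wallis /meridian -RintegralZ.
  apply: eq_Rintegral => b _; rewrite /rotang /rotpoly -horner_coef0.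
  rewrite hornerM !horner_exp !hornerE exprS -exprMn mulrCA mulrC; congr (_ * _).
  rewrite -exprMn; congr (_ ^+ _).
  by rewrite (sin_half b); field.
move=> b; apply: (@continuous_comp _ _ _ sin (fun x => x ^+ n.+1)); first exact: continuous_sin.
exact: exprn_continuous.
Qed.

(** The two step recurrence starts below index 0 on the odd indices.  It crosses
    the middle index n only by a vanishing factor, so the upper half is taken
    from the symmetry. *)
Lemma meridian_odd n a : (2 * a < 2 * n)%N -> meridian n (2 * a).+1 = 0 :> R.
Proof.
suff low c : (2 * c < n)%N -> meridian n (2 * c).+1 = 0 :> R.
  move=> lt; have [/low //|le] := ltnP (2 * a) n.
  have -> : (2 * a).+1 = (2 * n - (2 * (n - a.+1)).+1)%N by lia.
  by rewrite meridian_sym ?low ?mulr0//; lia.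
elim: c => [|c IH] lc.
  have := @meridian_ladder R n 0; rewrite (@eq_Rintegral _ _ _ _ _ (fun=> 0)); last first.
    by move=> b _; rewrite coefXM mul0r.
  rewrite Rintegral_cst//= mul0r mulr0 mul1r subr0 => /eqP.
  by rewrite mulf_eq0 natr1 pnatr_eq0 /= => /eqP.
have := @meridian_ladder R n (2 * c).+2.
rewrite (@eq_Rintegral _ _ R (@lebesgue_measure R) _ (fun b : R => (rotang n n b)`_(2 * c).+1 * sin b)); last first.
  by move=> b _; rewrite coefXM.
rewrite -/(meridian n (2 * c).+1) IH ?mulr0; last by lia.
have -> : n%:R + 1 - (2 * c).+2%:R = (n.+1 - (2 * c).+2)%:R :> R.
  by rewrite natrB ?natr1//; lia.
rewrite mulnS => /eqP; rewrite !mulf_eq0 !pnatr_eq0.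
by rewrite (_ : (n.+1 - (2 * c).+2 == 0)%N = false) /=; [move/eqP|lia].
Qed.

(** The factor of the meridian integrals that depends on the degree only. *)
Definition meridian_scale (n : nat) : R :=
  (dfact (n - 2))%:R * (if odd n then pi else 2) / (dfact n.+1)%:R.

(** Solution of the two step recurrence on the lower half of the indices.  On the
    upper half n - 2a would have to be replaced by its absolute value when n is
    even: this is why the recurrence cannot pass the middle. *)
Lemma meridian_even n a : (0 < n)%N -> (2 * a <= n)%N -> meridian n (2 * a) =
  (-1) ^+ n * (n%:R - 2 * a%:R) * 'C(n, a)%:R * (meridian_scale n / 2 ^+ n).
Proof.
move=> n0; elim: a => [|a IH] le.
  rewrite muln0 meridian0 bin0 /meridian_scale mulr0 subr0 mulr1.
  have : (dfact n.+1)%:R != 0 :> R by rewrite pnatr_eq0 -lt0n dfact_gt0.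
  rewrite (dfactE n0) (natrM _ n) (exprNn 2^-1) (exprVn 2).
  have : 2 ^+ n != 0 :> R by rewrite expf_neq0 ?pnatr_eq0.
  move: (2 ^+ n : R) ((dfact n.+1)%:R : R) ((dfact (n - 2))%:R : R) => x y z hx hy.
  by field; rewrite hx hy.
have := @meridian_ladder R n (2 * a).+1.
rewrite (@eq_Rintegral _ _ R (@lebesgue_measure R) _ (fun b : R => (rotang n n b)`_(2 * a) * sin b)); last first.
  by move=> b _; rewrite coefXM.
rewrite -/(meridian n (2 * a)) IH; last by lia.
have hb : a.+1%:R * 'C(n, a.+1)%:R = (n%:R - a%:R) * 'C(n, a)%:R :> R.
  by rewrite -natrM mul_bin_left natrM natrB//; lia.
have e2 : (2 * a.+1)%N = (2 * a).+2 by rewrite mulnS.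
rewrite -e2 => h.
have nz : n%:R - 2 * a%:R != 0 :> R.
  by rewrite -natrM -natrB ?pnatr_eq0; lia.
apply: (@mulfI _ (a.+1%:R * (n%:R - 2 * a%:R))); first by rewrite mulf_neq0// pnatr_eq0.
transitivity (2^-1 * ((2 * a.+1)%:R * (n%:R + 1 - (2 * a).+1%:R) * meridian n (2 * a.+1)) : R).
  by rewrite natrM -(@natr1 _ (2 * a)) natrM; field.
rewrite h [RHS](_ : _ = (a.+1%:R * 'C(n, a.+1)%:R) * ((-1) ^+ n * (n%:R - 2 * a%:R)
    * (n%:R - 2 * a.+1%:R) * (meridian_scale n / 2 ^+ n))); last by ring.
rewrite hb -(@natr1 _ (2 * n)) -(@natr1 _ (2 * a)) -(@natr1 _ a) !natrM; field.
by rewrite expf_neq0 ?pnatr_eq0.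
Qed.

Lemma meridian_even_sq n a : (0 < n)%N -> (a <= n)%N -> meridian n (2 * a) ^+ 2 =
  ((n%:R - 2 * a%:R) * 'C(n, a)%:R * (meridian_scale n / 2 ^+ n)) ^+ 2.
Proof.
move=> n0 le; have [le2|lt] := leqP (2 * a) n.
  by rewrite meridian_even// -!mulrA exprMn sqrr_sign mul1r.
have -> : (2 * a = 2 * n - 2 * (n - a))%N by lia.
rewrite meridian_sym; last by lia.
rewrite exprMn sqrr_sign mul1r meridian_even//; last by lia.
rewrite -!mulrA exprMn sqrr_sign mul1r bin_sub// natrB//.
ring.
Qed.

Lemma sum_even (f : nat -> R) n : (forall a, (a < n)%N -> f (2 * a).+1 = 0) ->
  \sum_(m < (2 * n).+1) f m = \sum_(a < n.+1) f (2 * a)%N.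
Proof.
elim: n => [|n IH] h; first by rewrite muln0 !big_ord1.
rewrite [in RHS]big_ord_recr (_ : 2 * n.+1 = (2 * n).+2)%N; last by rewrite mulnS.
rewrite (big_ord_recr (2 * n).+2) (big_ord_recr (2 * n).+1) /= h// addr0 IH; last by move=> a la; apply: h; lia.
by rewrite -[(2 * n).+2]/(2 + 2 * n)%N -mulnS.
Qed.

(** Up to 1/(8 pi), the squared norm of the transform of a spherical harmonic of
    degree n. *)
Definition meridian_norm (n : nat) : R :=
  \sum_(m < (2 * n).+1) (m`!%:R * (2 * n - m)`!%:R / n`!%:R ^+ 2) * meridian n m ^+ 2.

(** The factorial weights turn the squared binomial coefficients of
    [meridian_even] into products of two central binomial coefficients. *)
Lemma meridian_normE n : (0 < n)%N ->
  meridian_norm n = n%:R * n.+1%:R / 2 * meridian_scale n ^+ 2.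
Proof.
move=> n0; rewrite /meridian_norm.
rewrite (sum_even (f := fun m => (m`!%:R * (2 * n - m)`!%:R / n`!%:R ^+ 2) * meridian n m ^+ 2)); last first.
  by move=> a la; rewrite meridian_odd ?expr0n ?mulr0//; lia.
rewrite -central_second_moment mulr_suml; apply: eq_bigr => a _.
have la : (a <= n)%N by rewrite -ltnS.
rewrite meridian_even_sq// /central.
have fnz k : k`!%:R != 0 :> R by rewrite pnatr_eq0 -lt0n fact_gt0.
have b1 : 'C(2 * a, a)%:R = (2 * a)`!%:R / a`!%:R ^+ 2 :> R.
  have := @bin_fact (2 * a) a; rewrite (_ : 2 * a - a = a)%N; last by lia.
  by move=> <-; [rewrite !natrM; field; rewrite fnz|lia].
have b2 : 'C(2 * (n - a), n - a)%:R = (2 * n - 2 * a)`!%:R / (n - a)`!%:R ^+ 2 :> R.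
  have := @bin_fact (2 * (n - a)) (n - a); rewrite (_ : 2 * (n - a) - (n - a) = n - a)%N; last by lia.
  rewrite -mulnBr.
  by move=> <-; [rewrite !natrM; field; rewrite fnz|lia].
have b3 : 'C(n, a)%:R = n`!%:R / (a`!%:R * (n - a)`!%:R) :> R.
  by rewrite -(bin_fact la) !natrM; field; rewrite !fnz.
rewrite b1 b2 b3.
have e4 : 4 ^+ a * 4 ^+ (n - a) = (2 ^+ n) ^+ 2 :> R.
  by rewrite -exprD subnKC// exprAC; congr (_ ^+ _); ring.
have : 2 ^+ n != 0 :> R by rewrite expf_neq0 ?pnatr_eq0.
have : 4 ^+ a != 0 :> R by rewrite expf_neq0 ?pnatr_eq0.
have : 4 ^+ (n - a) != 0 :> R by rewrite expf_neq0 ?pnatr_eq0.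
have := fnz a; have := fnz (n - a)%N; have := fnz n.
move: e4; move: (4 ^+ a) (4 ^+ (n - a)) (2 ^+ n) => x y z.
move: (a`!%:R) ((n - a)`!%:R) (n`!%:R) => u v t e ht hv hu hy hx hz.
have -> : ((2 * a)`!%:R / u ^+ 2 / x * ((2 * n - 2 * a)`!%:R / v ^+ 2 / y)) =
  ((2 * a)`!%:R * (2 * n - 2 * a)`!%:R) / (u ^+ 2 * v ^+ 2 * (x * y)).
  by move: ((2 * a)`!%:R) ((2 * n - 2 * a)`!%:R) => ? ?; field; rewrite ?hx ?hy ?hu ?hv.
rewrite e.
by move: ((2 * a)`!%:R) ((2 * n - 2 * a)`!%:R) (meridian_scale n) => ? ? ?; field; rewrite ?hz ?hu ?hv ?ht.
Qed.

(** From n to n + 2 the ratio r is multiplied by (n + 2)/(n + 3), so (n + 1) r^2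
    increases and (n + 2) r^2 decreases; their values at 0 and 1 give the
    bounds. *)
Lemma dfact_ratio_bounds n :
  (2^-1 : R) <= (n.+1%:R : R) * ((dfact n)%:R / (dfact n.+1)%:R) ^+ 2 <= (2 : R).
Proof.
pose r m : R := (dfact m)%:R / (dfact m.+1)%:R.
have r0 m : 0 <= r m by rewrite divr_ge0.
have rS m : m.+3%:R * r m.+2 = m.+2%:R * r m.
  have : (dfact m.+1)%:R != 0 :> R by rewrite pnatr_eq0 -lt0n dfact_gt0.
  rewrite /r (_ : dfact m.+2 = m.+2 * dfact m)%N// (_ : dfact m.+3 = m.+3 * dfact m.+1)%N//.
  rewrite (natrM _ m.+2) (natrM _ m.+3); move: ((dfact m)%:R) ((dfact m.+1)%:R) => x y hy.
  by field; rewrite hy -natrD pnatr_eq0.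
suff [h1 h2] : 2^-1 <= n.+1%:R * r n ^+ 2 /\ n.+2%:R * r n ^+ 2 <= 2.
  rewrite -/(r n) h1 /=; apply: le_trans h2; apply: ler_wpM2r; first by rewrite exprn_ge0.
  by rewrite ler_nat.
have [k] := ubnP n; elim: k n => // k IH [|[|n]] // lk.
- by rewrite /r /= divr1 expr1n; split; lra.
- by rewrite /r /= ; split; lra.
have [] := IH n; first by lia.
have h := rS n; have := r0 n.
move: h; rewrite -(@natr1 _ n.+3) -(@natr1 _ n.+2) -(@natr1 _ n.+1) -(@natr1 _ n).
have : (0 : R) <= n%:R by [].
move: (n%:R) (r n) (r n.+2) => x s t x0 h s0 h1 h2.
have te : t = (x + 2) * s / (x + 3).
  by apply: (@mulfI _ (x + 1 + 1 + 1)); [lra|rewrite h; field; lra].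
have x3 : 0 < (x + 3) ^+ 2 by rewrite exprn_gt0//; lra.
split.
  apply: (le_trans h1); rewrite te -subr_ge0.
  have -> : (x + 1 + 1 + 1) * ((x + 2) * s / (x + 3)) ^+ 2 - (x + 1) * s ^+ 2 = s ^+ 2 / (x + 3).
    by field; lra.
  by rewrite divr_ge0 ?exprn_ge0//; lra.
apply: (le_trans _ h2); rewrite te -subr_ge0.
have -> : (x + 1 + 1) * s ^+ 2 - (x + 1 + 1 + 1 + 1) * ((x + 2) * s / (x + 3)) ^+ 2 =
   (x + 2) * s ^+ 2 / (x + 3) ^+ 2.
  by field; lra.
by rewrite divr_ge0 ?mulr_ge0 ?exprn_ge0//; lra.
Qed.

Lemma meridian_norm_bounds n : (1 : R) <= n.+1%:R * meridian_norm n <= 32.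
Proof.
case: n => [|n].
  rewrite /meridian_norm muln0 big_ord1 meridian0 /= !divr1 expr0 mul1r mul1r.
  by rewrite !expr1n !mulr1 mul1r; lra.
rewrite meridian_normE//.
have e : meridian_scale n.+1 = (dfact n.+1)%:R / (dfact n.+2)%:R * (if odd n.+1 then pi else 2) / n.+1%:R.
  rewrite /meridian_scale.
  rewrite (@dfactE n.+1)//.
  rewrite (natrM _ n.+1); have : (dfact n.+2)%:R != 0 :> R by rewrite pnatr_eq0 -lt0n dfact_gt0.
  have : n.+1%:R != 0 :> R by rewrite pnatr_eq0.
  move: ((dfact n.+2)%:R : R) (n.+1%:R : R) ((dfact (n.+1 - 2))%:R : R) => x y z hy hx.
  by field; rewrite hx hy.
rewrite e; set k := (if _ then _ else _).
have hk : 2 <= k <= 4.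
  rewrite /k; case: ifP => _; last by lra.
  by have := pihalf_lt2 R; have := pi_ge2 R => h1 h2; apply/andP; split; lra.
have := dfact_ratio_bounds n.+1.
move: (_ / _) => r.
rewrite -(@natr1 _ n.+1).
have : (1 : R) <= n.+1%:R by rewrite ler1n.
move: (n.+1%:R) k hk => x k /andP[k1 k2] x1 /andP[h1 h2].
have x0 : x != 0 by lra.
have -> : (x + 1) * (x * (x + 1) / 2 * (r * k / x) ^+ 2) = ((x + 1) * r ^+ 2) * k ^+ 2 * ((x + 1) / (2 * x)).
  by field.
set A := (x + 1) * r ^+ 2 in h1 h2 *.
have B1 : 1 / 2 <= (x + 1) / (2 * x) <= 1.
  by rewrite ler_pdivlMr ?ler_pdivrMr; lra.
move: ((x + 1) / _) B1 => B /andP[B1 B2].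
have K1 : 4 <= k ^+ 2 <= 16 by apply/andP; split; nra.
move: (k ^+ 2) K1 => K /andP[K1 K2].
have C1 : 2 <= A * K <= 32 by apply/andP; split; nra.
move: (A * K) C1 => D /andP[D1 D2].
by apply/andP; split; nra.
Qed.

End Meridian.

(** * Unit complex numbers, sphere and rotation coordinates *)

Section Expi.
Context {R : realType}.
Implicit Types x y : R.

Lemma expiD x y : expi (x + y) = expi x * expi y.
Proof.
rewrite /expi cosD sinD; apply/eqP; rewrite eq_complex /=; apply/andP; split; apply/eqP; ring.
Qed.

Lemma expi0 : expi 0 = 1 :> R[i].
Proof. by rewrite /expi cos0 sin0. Qed.

Lemma expiN x : expi (- x) = (expi x)^*.
Proof. by rewrite /expi cosN sinN. Qed.

Lemma expiMconj x : expi x * (expi x)^* = 1.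
Proof. by rewrite -expiN -expiD subrr expi0. Qed.

Lemma expiX x n : expi x ^+ n = expi (n%:R * x).
Proof.
elim: n => [|n IH]; first by rewrite expr0 mul0r expi0.
by rewrite exprS IH -expiD -natr1; congr expi; ring.
Qed.

Lemma expi_subn x n m : expi x ^+ n * (expi x)^* ^+ m = expi ((n%:Z - m%:Z)%:~R * x).
Proof.
rewrite -expiN !expiX -expiD; congr expi.
by rewrite rmorphB /= !pmulrn; ring.
Qed.

End Expi.

Section Coordinates.
Context {R : realType}.
Implicit Types a b c x y z : R.

Definition vec3 x y z : 'cV[R]_3 := \col_(i < 3) [:: x; y; z]`_i.

Lemma vec3_ex (v : 'cV[R]_3) : exists x y z, v = vec3 x y z.
Proof.
exists (v (Ordinal (isT : (0 < 3)%N)) 0), (v (Ordinal (isT : (1 < 3)%N)) 0),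
  (v (Ordinal (isT : (2 < 3)%N)) 0).
apply/colP => i; rewrite mxE; case: i => [[|[|[|]]]] //= i; congr (v _ 0); exact: val_inj.
Qed.

Lemma vec3_inj x y z x' y' z' : vec3 x y z = vec3 x' y' z' ->
  [/\ x = x', y = y' & z = z'].
Proof.
move=> /colP h; split.
- by have := h (Ordinal (isT : (0 < 3)%N)); rewrite !mxE.
- by have := h (Ordinal (isT : (1 < 3)%N)); rewrite !mxE.
- by have := h (Ordinal (isT : (2 < 3)%N)); rewrite !mxE.
Qed.

Lemma R3_vec3 a x y z :
  R3 a *m vec3 x y z = vec3 (cos a * x - sin a * y) (sin a * x + cos a * y) z.
Proof.
apply/colP => i; rewrite !mxE !big_ord_recl big_ord0 !mxE /=.
by case: i => [[|[|[|]]]] //= _; ring.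
Qed.

Lemma R2_vec3 a x y z :
  R2 a *m vec3 x y z = vec3 (cos a * x + sin a * z) y (- sin a * x + cos a * z).
Proof.
apply/colP => i; rewrite !mxE !big_ord_recl big_ord0 !mxE /=.
by case: i => [[|[|[|]]]] //= _; ring.
Qed.

Lemma Phi_R3 a b : Phi a b = R3 a *m Phi 0 b.
Proof.
by rewrite [Phi 0 b]/(vec3 _ _ _) R3_vec3 cos0 sin0 /Phi -/(vec3 _ _ _); congr vec3; ring.
Qed.

Lemma Phi_R3R2 a b : Phi a b = R3 a *m R2 b *m vec3 0 0 1.
Proof.
rewrite -mulmxA R2_vec3 R3_vec3 /Phi -/(vec3 _ _ _); congr vec3; ring.
Qed.

Lemma angle_exists x y : x ^+ 2 + y ^+ 2 = 1 ->
  exists2 a, 0 <= a < 2 * pi & cos a = x /\ sin a = y.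
Proof.
move=> h; have xB : -1 <= x <= 1 by apply/andP; split; nra.
have y2 : 1 - x ^+ 2 = y ^+ 2 by rewrite -h; ring.
have p0 := pi_gt0 R.
have [y0|y0] := leP 0 y.
  exists (acos x).
    by rewrite acos_ge0//=; have := acos_lepi xB; lra.
  by rewrite acosK ?in_itv//= sin_acos// y2 sqrtr_sqr ger0_norm.
exists (2 * pi - acos x).
  have : 0 < acos x by apply: acos_gt0; apply/andP; split; nra.
  by have := acos_lepi xB; lra.
have e : 2 * pi - acos x = - acos x + pi *+ 2 by rewrite mulr2n; ring.
rewrite e cosD2pi sinD2pi cosN sinN acosK ?in_itv//= sin_acos// y2 sqrtr_sqr.
by rewrite ltr0_norm// opprK.
Qed.

Lemma sphere_exists x y z : x ^+ 2 + y ^+ 2 + z ^+ 2 = 1 ->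
  exists a b, [/\ 0 <= a < 2 * pi, 0 <= b <= pi & Phi a b = vec3 x y z].
Proof.
move=> h; have zB : -1 <= z <= 1 by apply/andP; split; nra.
pose s := Num.sqrt (1 - z ^+ 2).
have s2 : s ^+ 2 = 1 - z ^+ 2 by rewrite sqr_sqrtr//; nra.
(* At the poles the longitude is arbitrary. *)
have [s0|s0] := eqVneq s 0.
  exists 0, (acos z); rewrite lexx acos_ge0// acos_lepi// mulr_gt0 ?pi_gt0//.
  split=> //; rewrite /Phi -/(vec3 _ _ _) acosK ?in_itv//= sin_acos// -/s s0.
  by move: s2; rewrite s0 => s2; congr vec3; nra.
have [|a aB [ca sa]] := @angle_exists (x / s) (y / s).
  rewrite !expr_div_n -mulrDl (_ : x ^+ 2 + y ^+ 2 = s ^+ 2); last by rewrite s2 -h; ring.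
  by rewrite divff// expf_neq0.
exists a, (acos z); rewrite aB acos_ge0// acos_lepi//; split=> //.
rewrite /Phi -/(vec3 _ _ _) acosK ?in_itv//= sin_acos// -/s ca sa.
by rewrite !divfK.
Qed.

Lemma sphere_coordP x y z : x ^+ 2 + y ^+ 2 + z ^+ 2 = 1 ->
  let p := sphere_coord (vec3 x y z) in
  [/\ 0 <= p.1 < 2 * pi, 0 <= p.2 <= pi & Phi p.1 p.2 = vec3 x y z].
Proof.
move=> /sphere_exists [a [b [h1 h2 h3]]].
rewrite /sphere_coord; set P := (X in xget _ X).
have : P (xget (0, 0) P) by apply: (@xgetI _ _ P (a, b)).
by [].
Qed.

(** Matrices given by the lists of their rows, so that products and determinants
    become identities between explicit entries. *)
Definition mat3 (l : seq (seq R)) : 'M[R]_3 := \matrix_(i < 3, j < 3) (nth [::] l i)`_j.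

Lemma mat3_ex (A : 'M[R]_3) : exists a b c d e f g h i,
  A = mat3 [:: [:: a; b; c]; [:: d; e; f]; [:: g; h; i]].
Proof.
pose o0 : 'I_3 := Ordinal (isT : (0 < 3)%N).
pose o1 : 'I_3 := Ordinal (isT : (1 < 3)%N).
pose o2 : 'I_3 := Ordinal (isT : (2 < 3)%N).
exists (A o0 o0), (A o0 o1), (A o0 o2), (A o1 o0), (A o1 o1), (A o1 o2),
  (A o2 o0), (A o2 o1), (A o2 o2).
apply/matrixP => i j; rewrite mxE.
by case: i => [[|[|[|]]]] //= i; case: j => [[|[|[|]]]] //= j; congr (A _ _); apply: val_inj.
Qed.

Lemma det_mat3 a b c d e f g h i :
  \det (mat3 [:: [:: a; b; c]; [:: d; e; f]; [:: g; h; i]]) =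
  a * (e * i - f * h) - b * (d * i - f * g) + c * (d * h - e * g).
Proof.
rewrite (expand_det_row _ ord0) !big_ord_recl big_ord0 /cofactor.
rewrite !(expand_det_row _ ord0) !big_ord_recl !big_ord0 /cofactor !det_mx11 !mxE /=.
by rewrite /bump /=; ring.
Qed.

Lemma mulmx_mat3 a b c d e f g h i a' b' c' d' e' f' g' h' i' :
  mat3 [:: [:: a; b; c]; [:: d; e; f]; [:: g; h; i]] *m
  mat3 [:: [:: a'; b'; c']; [:: d'; e'; f']; [:: g'; h'; i']] =
  mat3 [:: [:: a * a' + b * d' + c * g'; a * b' + b * e' + c * h'; a * c' + b * f' + c * i'];
           [:: d * a' + e * d' + f * g'; d * b' + e * e' + f * h'; d * c' + e * f' + f * i'];
           [:: g * a' + h * d' + i * g'; g * b' + h * e' + i * h'; g * c' + h * f' + i * i']].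
Proof.
apply/matrixP => k l; rewrite !mxE !big_ord_recl big_ord0 !mxE /=.
by case: k => [[|[|[|]]]] //= ?; case: l => [[|[|[|]]]] //= ?; ring.
Qed.

Lemma trmx_mat3 a b c d e f g h i :
  (mat3 [:: [:: a; b; c]; [:: d; e; f]; [:: g; h; i]])^T =
  mat3 [:: [:: a; d; g]; [:: b; e; h]; [:: c; f; i]].
Proof.
apply/matrixP => k l; rewrite !mxE.
by case: k => [[|[|[|]]]] //= ?; case: l => [[|[|[|]]]] //= ?.
Qed.

Lemma mat3_id : 1%:M = mat3 [:: [:: 1; 0; 0]; [:: 0; 1; 0]; [:: 0; 0; 1]].
Proof.
apply/matrixP => k l; rewrite !mxE.
by case: k => [[|[|[|]]]] //= ?; case: l => [[|[|[|]]]] //= ?.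
Qed.

Lemma mat3_inj a b c d e f g h i a' b' c' d' e' f' g' h' i' :
  mat3 [:: [:: a; b; c]; [:: d; e; f]; [:: g; h; i]] =
  mat3 [:: [:: a'; b'; c']; [:: d'; e'; f']; [:: g'; h'; i']] ->
  [/\ [/\ a = a', b = b' & c = c'], [/\ d = d', e = e' & f = f'] &
      [/\ g = g', h = h' & i = i']].
Proof.
pose o0 : 'I_3 := Ordinal (isT : (0 < 3)%N).
pose o1 : 'I_3 := Ordinal (isT : (1 < 3)%N).
pose o2 : 'I_3 := Ordinal (isT : (2 < 3)%N).
move=> /matrixP H.
by split; split; [have := H o0 o0|have := H o0 o1|have := H o0 o2|have := H o1 o0|
  have := H o1 o1|have := H o1 o2|have := H o2 o0|have := H o2 o1|have := H o2 o2];
  rewrite !mxE.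
Qed.

Lemma SO3_R3 a : SO3 (R3 a : 'M[R]_3).
Proof.
rewrite /SO3 /= /R3 -/(mat3 _) trmx_mat3 mulmx_mat3 det_mat3 mat3_id.
have h := cos2Dsin2 a.
split; [congr mat3; congr [:: [:: _; _; _]; [:: _; _; _]; [:: _; _; _]]|];
  first [ring | by rewrite -[RHS]h; ring].
Qed.

Lemma SO3_R2 a : SO3 (R2 a : 'M[R]_3).
Proof.
rewrite /SO3 /= /R2 -/(mat3 _) trmx_mat3 mulmx_mat3 det_mat3 mat3_id.
have h := cos2Dsin2 a.
split; [congr mat3; congr [:: [:: _; _; _]; [:: _; _; _]; [:: _; _; _]]|];
  first [ring | by rewrite -[RHS]h; ring].
Qed.

Lemma SO3_mul (P Q : 'M[R]_3) : SO3 P -> SO3 Q -> SO3 (P *m Q).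
Proof.
move=> [hP dP] [hQ dQ]; split; last by rewrite det_mulmx dP dQ mulr1.
by rewrite trmx_mul mulmxA -(mulmxA P) hQ mulmx1.
Qed.

Lemma SO3_tr (P : 'M[R]_3) : SO3 P -> SO3 P^T.
Proof. by move=> [hP dP]; split; [rewrite trmxK; exact: mulmx1C|rewrite det_tr]. Qed.

Lemma SO3_Psi a b c : SO3 (Psi a b c : 'M[R]_3).
Proof.
by apply: SO3_mul; [apply: SO3_mul; [exact: SO3_R3|exact: SO3_R2]|exact: SO3_R3].
Qed.

Lemma SO3_unit (Q : 'M[R]_3) x y z x' y' z' : SO3 Q -> Q *m vec3 x y z = vec3 x' y' z' ->
  x' ^+ 2 + y' ^+ 2 + z' ^+ 2 = x ^+ 2 + y ^+ 2 + z ^+ 2.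
Proof.
have E u v w : u ^+ 2 + v ^+ 2 + w ^+ 2 = ((vec3 u v w)^T *m vec3 u v w) 0 0.
  by rewrite !mxE !big_ord_recl big_ord0 !mxE /=; ring.
move=> [hQ _] h; rewrite !E -h trmx_mul mulmxA -(mulmxA _ Q^T) (mulmx1C hQ) mulmx1.
by [].
Qed.

(** The angles a and b are spherical coordinates of the image of the north pole;
    removing them leaves a rotation that fixes the pole, hence some R3 c. *)
Lemma euler_exists (Q : 'M[R]_3) : SO3 Q ->
  exists a b c, [/\ 0 <= a < 2 * pi, 0 <= b <= pi, 0 <= c < 2 * pi & Psi a b c = Q].
Proof.
move=> hQ.
have [x [y [z hx]]] := vec3_ex (Q *m vec3 0 0 1).
have [|a [b [aB bB hab]]] := @sphere_exists x y z.
  by rewrite (SO3_unit hQ hx) !expr0n expr1n !add0r.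
pose S := R3 a *m R2 b.
have hS : SO3 S by apply: SO3_mul; [exact: SO3_R3|exact: SO3_R2].
have hP : SO3 (S^T *m Q) by apply: SO3_mul => //; exact: SO3_tr.
have S1 : S^T *m S = 1%:M by apply: mulmx1C; case: hS.
have Pe : S^T *m Q *m vec3 0 0 1 = vec3 0 0 1.
  by rewrite -mulmxA hx -hab Phi_R3R2 mulmxA S1 mul1mx.
have [p11 [p12 [p13 [p21 [p22 [p23 [p31 [p32 [p33 hM]]]]]]]]] := mat3_ex (S^T *m Q).
rewrite hM in Pe hP.
have mv a1 a2 a3 b1 b2 b3 c1 c2 c3 :
    mat3 [:: [:: a1; a2; a3]; [:: b1; b2; b3]; [:: c1; c2; c3]] *m vec3 0 0 1 = vec3 a3 b3 c3.
  apply/colP => i; rewrite !mxE !big_ord_recl big_ord0 !mxE /=.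
  by case: i => [[|[|[|]]]] //= _; ring.
move: Pe; rewrite mv => /vec3_inj [p13E p23E p33E]; subst p13 p23 p33.
case: hP => hPP; rewrite det_mat3 => dP.
move: hPP; rewrite trmx_mat3 mulmx_mat3 mat3_id => /mat3_inj.
move=> [[h11 h12 h13] [h21 h22 h23] [h31 h32 h33]].
have sq0 u v : u ^+ 2 + v ^+ 2 = 0 -> u = 0 /\ v = 0 :> R.
  move=> /eqP; rewrite paddr_eq0 ?sqr_ge0// !sqrf_eq0 => /andP[/eqP -> /eqP ->].
  by [].
have [q1 q2] : p31 = 0 /\ p32 = 0 by apply: sq0; lra.
subst p31 p32.
(* The sum of the two squares is 2 - 2 det. *)
have [k1 k2] : p11 - p22 = 0 /\ p12 + p21 = 0 by apply: sq0; lra.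
have [|c cB [hc hs]] := @angle_exists p11 p21; first by nra.
exists a, b, c; split=> //.
have -> : Q = S *m (S^T *m Q) by case: hS => hS _; rewrite mulmxA hS mul1mx.
rewrite /Psi -/S hM /R3 -/(mat3 _) hc hs.
by congr (S *m mat3 [:: [:: _; _; _]; [:: _; _; _]; [:: _; _; _]]); lra.
Qed.

Lemma euler_anglesP (Q : 'M[R]_3) : SO3 Q ->
  let p := euler_angles Q in
  [/\ 0 <= p.1.1 < 2 * pi, 0 <= p.1.2 <= pi, 0 <= p.2 < 2 * pi
    & Psi p.1.1 p.1.2 p.2 = Q].
Proof.
move=> /euler_exists [a [b [c [h1 h2 h3 h4]]]].
rewrite /euler_angles; set P := (X in xget _ X).
have : P (xget (0, 0, 0) P) by apply: (@xgetI _ _ P (a, b, c)).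
by [].
Qed.

End Coordinates.

(** * Rotation of the spherical harmonics *)

Section NullForm.
Context {R : realType}.
Implicit Types a b c x y z : R.
Local Notation toC := (map_poly (real_complex R)).

(** The polynomial q_x of the introduction: the scalar product of x with the null
    vector ((X^2 - 1)/2, - i (X^2 + 1)/2, X). *)
Definition null_form3 x y z : {poly R[i]} :=
  (2^-1 * (x -i* y))%:P * 'X^2 + (z%:C)%:P * 'X + (- (2^-1 * (x +i* y)))%:P.

Definition null_form (v : 'cV[R]_3) : {poly R[i]} :=
  null_form3 (v (Ordinal (isT : (0 < 3)%N)) 0) (v (Ordinal (isT : (1 < 3)%N)) 0)
    (v (Ordinal (isT : (2 < 3)%N)) 0).

Lemma null_form_vec3 x y z : null_form (vec3 x y z) = null_form3 x y z.
Proof. by rewrite /null_form !mxE. Qed.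

Lemma null_form_R3 a v m n : (m <= 2 * n)%N ->
  (null_form (R3 a *m v) ^+ n)`_m =
  expi ((n%:Z - m%:Z)%:~R * a) * (null_form v ^+ n)`_m.
Proof.
move=> le; have [x [y [z ->]]] := vec3_ex v; rewrite R3_vec3 !null_form_vec3.
have -> : null_form3 (cos a * x - sin a * y) (sin a * x + cos a * y) z =
  (expi a)%:P * (null_form3 x y z \Po ((expi a)^* *: 'X)).
  rewrite /null_form3 (expr2 'X) !comp_polyD !comp_polyM !comp_polyC comp_polyX.
  have hE := expiMconj a.
  have e1 : (cos a * x - sin a * y) +i* (sin a * x + cos a * y) = expi a * (x +i* y).
    by rewrite /expi; apply/eqP; rewrite eq_complex /=; apply/andP; split; apply/eqP; ring.
  have e2 : (cos a * x - sin a * y) -i* (sin a * x + cos a * y) = (expi a)^* * (x -i* y).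
    by rewrite /expi; apply/eqP; rewrite eq_complex /=; apply/andP; split; apply/eqP; ring.
  rewrite e1 e2; move: hE; move: (expi a) ((expi a)^*) (x +i* y) (x -i* y) (z%:C) => E F u w t hE.
  rewrite -mul_polyC.
  have hEp : E%:P * F%:P = 1 by rewrite -polyCM hE.
  rewrite !(polyCM, polyCN).
  move: hEp; move: E%:P F%:P u%:P w%:P t%:P (2^-1)%:P ('X : {poly R[i]}) => e f p q r s X h.
  by rewrite -[X in _ = X](_ : s * (f * q) * (X * X) * (e * f) + r * X * (e * f) - s * (e * p) = _);
    [rewrite h !mulr1|ring].
rewrite exprMn -(rmorphXn (@polyC R[i])) /= coefCM -(rmorphXn (comp_poly ((expi a)^* *: 'X))) /=.
by rewrite coef_comp_scale mulrA expi_subn.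
Qed.

(** The rotation R2 b acts on q_x by the Moebius map h / g, with half-angles
    because SU(2) covers the rotations twice. *)
Lemma null_form_R2 b v m n :
  (null_form (R2 b *m v) ^+ n)`_m =
  \sum_(j < (2 * n).+1) (null_form v ^+ n)`_j * ((rotang (2 * n - j) j b)`_m)%:C.
Proof.
have [x [y [z ->]]] := vec3_ex v; rewrite R2_vec3 !null_form_vec3.
pose g := toC ((cos (b / 2))%:P + (sin (b / 2))%:P * 'X).
pose h := toC ((cos (b / 2))%:P * 'X - (sin (b / 2))%:P).
have -> : null_form3 (cos b * x + sin b * z) y (- sin b * x + cos b * z) =
  (2^-1 * (x -i* y))%:P * h ^+ 2 + (z%:C)%:P * (h * g) + (- (2^-1 * (x +i* y)))%:P * g ^+ 2.
  have cs : (cos (b / 2))%:C ^+ 2 + (sin (b / 2))%:C ^+ 2 = 1 :> R[i].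
    by rewrite -!rmorphXn -rmorphD /= cos2Dsin2.
  have cb : (cos b)%:C = (cos (b / 2))%:C ^+ 2 - (sin (b / 2))%:C ^+ 2.
    by rewrite -!rmorphXn -rmorphB /= -cos_half.
  have sb : (sin b)%:C = 2 * (cos (b / 2))%:C * (sin (b / 2))%:C.
    by rewrite (sin_half b) !rmorphM /= rmorph_nat.
  have e1 : (cos b * x + sin b * z) -i* y = (cos b)%:C * x%:C + (sin b)%:C * z%:C - 'i * y%:C.
    by apply/eqP; rewrite eq_complex /=; apply/andP; split; apply/eqP; ring.
  have e2 : (cos b * x + sin b * z) +i* y = (cos b)%:C * x%:C + (sin b)%:C * z%:C + 'i * y%:C.
    by apply/eqP; rewrite eq_complex /=; apply/andP; split; apply/eqP; ring.
  have e3 : x -i* y = x%:C - 'i * y%:C.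
    by apply/eqP; rewrite eq_complex /=; apply/andP; split; apply/eqP; ring.
  have e4 : x +i* y = x%:C + 'i * y%:C.
    by apply/eqP; rewrite eq_complex /=; apply/andP; split; apply/eqP; ring.
  have e5 : (- sin b * x + cos b * z)%:C = - (sin b)%:C * x%:C + (cos b)%:C * z%:C.
    by rewrite rmorphD !rmorphM rmorphN.
  have -> : g = (cos (b / 2))%:C%:P + (sin (b / 2))%:C%:P * 'X.
    by rewrite /g rmorphD rmorphM /= !map_polyC map_polyX.
  have -> : h = (cos (b / 2))%:C%:P * 'X - (sin (b / 2))%:C%:P.
    by rewrite /h rmorphB rmorphM /= !map_polyC map_polyX.
  rewrite /null_form3 e1 e2 e3 e4 e5 cb sb; move: cs.
  move: (cos (b / 2))%:C (sin (b / 2))%:C x%:C y%:C z%:C ('i : R[i]) => C S X Y Z I cs.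
  have csp : C%:P ^+ 2 + S%:P ^+ 2 = 1 by rewrite -!polyC_exp -polyCD cs.
  have i2 : 2 * (2^-1 : R[i])%:P = 1.
    by rewrite -(polyC_natr R[i] 2) -polyCM divff// pnatr_eq0.
  rewrite !(polyCM, polyCB, polyCN, polyCD) polyC1.
  move: csp i2; move: C%:P S%:P X%:P Y%:P Z%:P I%:P (2^-1)%:P ('X : {poly R[i]}).
  move=> c s p q r i e V csp i2.
  apply/eqP; rewrite -subr_eq0; apply/eqP.
  transitivity ((2 * e - 1) * (c * s * r * V ^+ 2 + 2 * c * s * p * V - c * s * r) +
     (c ^+ 2 + s ^+ 2 - 1) * (e * i * q * (V ^+ 2 + 1))); first by ring.
  by rewrite csp i2 !subrr !mul0r addr0.
rewrite homogenize_quadratic coef_sum; apply: eq_bigr => j _.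
rewrite coefZ; congr (_ * _); rewrite /rotang /rotpoly -coef_map /= !(rmorphM, rmorphXn) /=.
by rewrite mulrC.
Qed.

End NullForm.

(** * Spherical harmonics as coefficients *)

Section Spherical.
Context {R : realType}.

Lemma derive1n_horner (P : {poly R}) r :
  derive1n r (horner P) = horner P^`(r).
Proof.
elim: r => [|r IH]; first by rewrite derive1n0 derivn0.
by rewrite derive1nS IH derivnS derivE.
Qed.

Lemma derive1n_horner_coef (P : {poly R}) r x :
  derive1n r (horner P) x = r`!%:R * (P \Po ('X + x%:P))`_r.
Proof.
by rewrite derive1n_horner nderivn_def coef_comp_shift hornerMn mulr_natl.
Qed.

(** The Taylor expansion of (t^2 - 1)^n at cos b, with the increment scaled by
    sin b, is f(n, n, b) up to a power of the sine.  At the poles that power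
    cannot be cancelled and both sides are computed directly. *)
Lemma rodrigues n k (b : R) : (k <= n)%N ->
  sin b ^+ k * ((('X^2 - 1) ^+ n) \Po ('X + (cos b)%:P))`_(n + k) =
  2 ^+ n * (rotang n n b)`_(n + k).
Proof.
move=> lek; rewrite /rotang rotpoly_diag.
have -> : cos (b / 2) * sin (b / 2) = sin b / 2 by rewrite (sin_half b); field.
rewrite -cos_half; have := cos2Dsin2 b; move: (cos b) (sin b) => t s ts.
have -> : ('X^2 - 1) ^+ n \Po ('X + t%:P) = ('X^2 + (2 * t) *: 'X - (s ^+ 2)%:P) ^+ n.
  rewrite [comp_poly _ _](rmorphXn (comp_poly ('X + t%:P))) /=; congr (_ ^+ _).
  rewrite rmorphB /= (expr2 'X) comp_polyM comp_polyX rmorph1.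
  have -> : s ^+ 2 = 1 - t ^+ 2 by rewrite -ts; ring.
  by rewrite -mul_polyC polyCB !polyCM !polyCD !polyC1; ring.
set A := _ ^+ n; set B := (_ + _ + _) ^+ n.
have scaled : A \Po (s *: 'X) = (s ^+ n * 2 ^+ n) *: B.
  rewrite /A [comp_poly _ _](rmorphXn (comp_poly (s *: 'X))) /=.
  rewrite -exprMn -exprZn; congr (_ ^+ _).
  rewrite rmorphB rmorphD /= (expr2 'X) comp_polyM comp_polyZ comp_polyX comp_polyC.
  rewrite -!mul_polyC !polyCM !polyCN !polyCM !polyCD polyC1.
  have h : 2 * (2^-1 : R)%:P = 1 by rewrite -(polyC_natr R 2) -polyCM divff// pnatr_eq0.
  move: h; move: s%:P t%:P (2^-1)%:P ('X : {poly R}) => S T H X h.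
  apply/eqP; rewrite -subr_eq0; apply/eqP.
  transitivity ((1 - 2 * H) * (S ^+ 2 * X ^+ 2 - S ^+ 2)); first by ring.
  by rewrite h subrr mul0r.
have /(congr1 (fun P : {poly R} => P`_(n + k))) := scaled.
rewrite coef_comp_scale coefZ.
(* Off the poles a power of the sine cancels. *)
have [s0|s0] := eqVneq s 0; last first.
  rewrite exprD -!mulrA => /(mulfI _); apply.
  by rewrite expf_neq0.
move=> _; rewrite /A /B s0 !(mul0r, expr0n) /= !(polyC0, mul0r, oppr0, addr0, add0r).
rewrite exprMn -polyC_exp coefCM coefXn.
rewrite (_ : 'X^2 + _ *: 'X = 'X * ('X + (2 * t)%:P)); last first.
  by rewrite -mul_polyC expr2; ring.
case: k {lek} => [|k]; last first.
  by rewrite mul0r (_ : (n + k.+1 == n)%N = false) ?mulr0//; lia.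
rewrite mul1r addn0 eqxx mulr1 exprMn mulrC coefMXn ltnn subnn -horner_coef0.
by rewrite horner_exp !hornerE exprMn.
Qed.

Lemma legendreE n k (b : R) : 0 <= b <= pi -> (k <= n)%N ->
  legendre n k (cos b) = (n + k)`!%:R / n`!%:R * (rotang n n b)`_(n - k) :> R.
Proof.

move=> bB lek.
have s0 : 0 <= sin b by apply: sin_ge0_pi.
rewrite /legendre -sin2cos2 sqrtr_sqr ger0_norm//.
have -> : (fun s : R => (s ^+ 2 - 1) ^+ n) = horner (('X^2 - 1) ^+ n).
  by apply/funext => x; rewrite horner_exp !hornerE.
rewrite derive1n_horner_coef.
have h := rodrigues b lek.
have -> : (rotang n n b)`_(n - k) = (-1) ^+ k * (rotang n n b)`_(n + k).
  have -> : (n + k = 2 * n - (n - k))%N by lia.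
  rewrite /rotang rotpoly_sym; last by lia.
  rewrite mulrA -exprD (_ : k + (n + (n - k)) = 2 * n)%N; last by lia.
  by rewrite exprM sqrrN !expr1n mul1r.
have p2 : 2 ^+ n != 0 :> R by rewrite expf_neq0 ?pnatr_eq0.
have fn : n`!%:R != 0 :> R by rewrite pnatr_eq0 -lt0n fact_gt0.
have -> : (rotang n n b)`_(n + k) = (2 ^+ n)^-1 * (sin b ^+ k * ((('X^2 - 1) ^+ n) \Po ('X + (cos b)%:P))`_(n + k)).
  by rewrite h mulrA mulVf// mul1r.
move: p2 fn; move: (2 ^+ n : R) (n`!%:R : R) => x y hx hy.
by field; rewrite hx hy.
Qed.

(** Ratio of the spherical harmonic of degree n and order n - m to the coefficient
    of X^m in q_x^n. *)
Definition sphnorm (n m : nat) : R :=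
  Num.sqrt ((2 * n%:R + 1) / (4 * pi) * (m`!%:R * (2 * n - m)`!%:R / n`!%:R ^+ 2)).

Lemma sqrt_sqr_mul (x y : R) : 0 <= y -> Num.sqrt (x * y ^+ 2) = Num.sqrt x * y.
Proof.
by move=> y0; rewrite mulrC sqrtrM ?sqr_ge0// sqrtr_sqr ger0_norm// mulrC.
Qed.

Lemma factz_add n m : (m <= 2 * n)%N ->
  factz (n%:Z - (n%:Z - m%:Z)) = m`!%:R :> R /\
  factz (n%:Z + (n%:Z - m%:Z)) = (2 * n - m)`!%:R :> R.
Proof.
by move=> le; rewrite /factz; split; congr (_ `!%:R); lia.
Qed.

(** The symmetry of f(n, n, b) absorbs the separate definition of the associated
    Legendre functions of negative order. *)
Lemma assoc_legendreE n m (b : R) : 0 <= b <= pi -> (m <= 2 * n)%N ->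
  let k := n%:Z - m%:Z in
  Num.sqrt ((2 * n%:R + 1) / (4 * pi) * (factz (n%:Z - k) / factz (n%:Z + k))) *
   assoc_legendre n k (cos b) = sphnorm n m * (rotang n n b)`_m.
Proof.
move=> bB le k; have [e1 e2] := factz_add le; rewrite e1 e2.
have fn i : i`!%:R != 0 :> R by rewrite pnatr_eq0 -lt0n fact_gt0.
have fp i : 0 <= i`!%:R :> R by [].
have ->: sphnorm n m = Num.sqrt ((2 * n%:R + 1) / (4 * pi) * (m`!%:R / (2 * n - m)`!%:R)) * ((2 * n - m)`!%:R / n`!%:R).
  rewrite -sqrt_sqr_mul ?divr_ge0// /sphnorm; congr Num.sqrt; rewrite -!mulrA; congr (_ * (_ * _)).
  by move: (fn m) (fn (2 * n - m)%N) (fn n); move: (m`!%:R : R) ((2 * n - m)`!%:R : R) (n`!%:R : R) => x y z hx hy hz; field; rewrite hy hz.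
rewrite -[RHS]mulrA; congr (_ * _); rewrite /assoc_legendre /k.
have [lemn|ltnm] := leqP m n.
  have -> : 0 <= n%:Z - m%:Z by lia.
  have -> : `|n%:Z - m%:Z|%N = (n - m)%N by lia.
  rewrite legendreE//; last by lia.
  have -> : (n - (n - m) = m)%N by lia.
  by have -> : (n + (n - m) = 2 * n - m)%N by lia.
have -> : (0 <= n%:Z - m%:Z) = false by lia.
have -> : `|n%:Z - m%:Z|%N = (m - n)%N by lia.
rewrite legendreE//; last by lia.
have -> : factz (n%:Z - (m - n)%N%:Z) = (2 * n - m)`!%:R :> R.
  by rewrite /factz; congr (_`!%:R); lia.
have -> : factz (n%:Z + (m - n)%N%:Z) = m`!%:R :> R.
  by rewrite /factz; congr (_`!%:R); lia.
have -> : (n + (m - n) = m)%N by lia.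
have -> : (n - (m - n) = 2 * n - m)%N by lia.
rewrite /rotang rotpoly_sym// -[in RHS]mulrA; set r := _`_m.
have -> : (-1) ^+ (m - n) = (-1) ^+ (n + m) :> R.
  have -> : (n + m = m - n + 2 * n)%N by lia.
  by rewrite exprD exprM sqrrN !expr1n mulr1.
have sg : (-1) ^+ (n + m) * (-1) ^+ (n + m) = 1 :> R by rewrite -expr2 sqrr_sign.
transitivity ((2 * n - m)`!%:R / n`!%:R * ((-1) ^+ (n + m) * (-1) ^+ (n + m)) * r); last by rewrite sg mulr1 mulrA.
by move: (fn m) (fn n); move: (m`!%:R : R) ((2 * n - m)`!%:R : R) (n`!%:R : R) => x y z hx hz; field; rewrite hx hz.
Qed.

Lemma null_form_meridian n j (b : R) :
  (null_form (Phi 0 b) ^+ n)`_j = ((rotang n n b)`_j)%:C.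
Proof.
rewrite [Phi 0 b]/(vec3 _ _ _) null_form_vec3 /null_form3 cos0 sin0 mul1r mul0r.
rewrite /rotang rotpoly_diag.
have -> : cos (b / 2) * sin (b / 2) = sin b / 2 by rewrite (sin_half b); field.
rewrite -cos_half oppr0.
rewrite -coef_map /= rmorphXn /= !rmorphD !rmorphM /= !map_polyX !map_polyC /=.
have -> : (- (sin b / 2))%:C = - (2^-1 * (sin b)%:C).
  by rewrite rmorphN rmorphM /= fmorphV /= rmorph_nat mulrC.
have h2 : (2^-1)%:C = 2^-1 :> R[i] by rewrite fmorphV /= rmorph_nat.
by rewrite h2 (mulrC (2^-1)%:P).
Qed.

Lemma YnkE n m (x y z : R) : x ^+ 2 + y ^+ 2 + z ^+ 2 = 1 -> (m <= 2 * n)%N ->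
  Ynk n (n%:Z - m%:Z) (vec3 x y z) = (sphnorm n m)%:C * (null_form (vec3 x y z) ^+ n)`_m.
Proof.
move=> h le; rewrite /Ynk; have := sphere_coordP h.
case: (sphere_coord _) => a b /= [aB bB <-].
rewrite assoc_legendreE// Phi_R3 null_form_R3// null_form_meridian rmorphM /=.
by rewrite -!mulrA; congr (_ * _); rewrite mulrC.
Qed.

End Spherical.

(** * Wigner functions as coefficients *)

Section Wigner.
Context {R : realType}.

(** Ratio of the Wigner function of orders n - m and n - j to the coefficient of
    X^m in f(2n-j, j, b). *)
Definition wignorm (n m j : nat) : R :=
  Num.sqrt (m`!%:R * (2 * n - m)`!%:R / (j`!%:R * (2 * n - j)`!%:R)).

(** As for the spherical harmonics: here 1 + t = 2 c^2 and 1 - t = 2 s^2, and the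
    Taylor increment is scaled by 2 c s, the sine of the angle. *)
Lemma wigner_rodrigues (c s : R) p q m : c ^+ 2 + s ^+ 2 = 1 ->
  (2 * c * s) ^+ m * (((1 + 'X) ^+ p * (1 - 'X) ^+ q) \Po ('X + (c ^+ 2 - s ^+ 2)%:P))`_m =
  (2 * c) ^+ p * (2 * s) ^+ q * (-1) ^+ q * (rotpoly c s p q)`_m.
Proof.
move=> cs; rewrite -coef_comp_scale.
have -> : ((1 + 'X) ^+ p * (1 - 'X) ^+ q) \Po ('X + (c ^+ 2 - s ^+ 2)%:P) =
   ('X + (2 * c ^+ 2)%:P) ^+ p * ((2 * s ^+ 2)%:P - 'X) ^+ q.
  rewrite comp_polyM [comp_poly _ (_ ^+ p)](rmorphXn (comp_poly _)) /=.
  rewrite [comp_poly _ (_ ^+ q)](rmorphXn (comp_poly _)) /=.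
  rewrite comp_polyB comp_polyD -[1 in LHS]polyC1 !comp_polyC comp_polyX.
  congr (_ ^+ _ * _ ^+ _).
    have -> : 2 * c ^+ 2 = 1 + (c ^+ 2 - s ^+ 2) by lra.
    by rewrite (polyCD 1) polyC1; ring.
  have -> : 2 * s ^+ 2 = 1 - (c ^+ 2 - s ^+ 2) by lra.
  by rewrite (polyCB 1) polyC1; ring.
rewrite comp_polyM [comp_poly _ (_ ^+ p)](rmorphXn (comp_poly _)) /=.
rewrite [comp_poly _ (_ ^+ q)](rmorphXn (comp_poly _)) /=.
rewrite comp_polyB comp_polyD !comp_polyC comp_polyX.
have -> : (2 * c * s) *: 'X + (2 * c ^+ 2)%:P = (2 * c) *: (c%:P + s%:P * 'X).
  by rewrite -!mul_polyC !polyCM; ring.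
have -> : (2 * s ^+ 2)%:P - (2 * c * s) *: 'X = (- (2 * s)) *: (c%:P * 'X - s%:P).
  by rewrite -!mul_polyC polyCN !polyCM; ring.
rewrite (exprZn (2 * c)) (exprZn (- (2 * s))) -scalerAl -scalerAr !coefZ /rotpoly.
by rewrite (exprNn (2 * s)); ring.
Qed.

Lemma wigner_formulaE n m j (c s : R) : 0 < c -> 0 < s -> c ^+ 2 + s ^+ 2 = 1 ->
  (m <= 2 * n)%N -> (j <= 2 * n)%N ->
  wigner_d_formula n (n%:Z - m%:Z) (n%:Z - j%:Z) (c ^+ 2 - s ^+ 2) =
  wignorm n m j * (rotpoly c s (2 * n - j) j)`_m.
Proof.
move=> c0 s0 cs lem lej.
have [e1 e2] := @factz_add R _ _ lem; have [e3 e4] := @factz_add R _ _ lej.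
rewrite /wigner_d_formula e1 e2 e3 e4.
have -> : n%:Z - (n%:Z - j%:Z) = j%:Z by ring.
have -> : n%:Z - (n%:Z - m%:Z) = m%:Z by ring.
have -> : n%:Z + (n%:Z - j%:Z) = (2 * n - j)%N%:Z by lia.
have -> : - n%:Z + (n%:Z - j%:Z) = - j%:Z by ring.
have -> : n%:Z - j%:Z - (n%:Z - m%:Z) = m%:Z - j%:Z by ring.
have -> : n%:Z - j%:Z + (n%:Z - m%:Z) = (2 * n - j)%N%:Z - m%:Z by lia.
rewrite -exprnP absz_nat.
set p := (2 * n - j)%N.
have -> : (fun u : R => (1 + u) ^ p%:Z / (1 - u) ^ (- j%:Z)) =
   horner ((1 + 'X) ^+ p * (1 - 'X) ^+ j).
  apply/funext => u; rewrite hornerM !horner_exp !hornerE.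
  by rewrite -exprnP -invr_expz invrK -exprnP.
rewrite derive1n_horner_coef.
have t1 : 1 - (c ^+ 2 - s ^+ 2) = 2 * s ^+ 2 by lra.
have t2 : 1 + (c ^+ 2 - s ^+ 2) = 2 * c ^+ 2 by lra.
rewrite t1 t2.
have cN : c != 0 by rewrite gt_eqF.
have sN : s != 0 by rewrite gt_eqF.
have c2N : 2 * c ^+ 2 != 0 by rewrite mulf_neq0 ?expf_neq0 ?pnatr_eq0.
have s2N : 2 * s ^+ 2 != 0 by rewrite mulf_neq0 ?expf_neq0 ?pnatr_eq0.
rewrite !expfzDr// -!invr_expz -!exprnP.
set co := (_ `_ m).
have hco : co = ((2 * c * s) ^+ m)^-1 * ((2 * c) ^+ p * (2 * s) ^+ j * (-1) ^+ j * (rotpoly c s p j)`_m).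
  have := wigner_rodrigues p j m cs => <-.
  by rewrite mulKf// expf_neq0// !mulf_neq0// pnatr_eq0.
rewrite hco.
have fn i : i`!%:R != 0 :> R by rewrite pnatr_eq0 -lt0n fact_gt0.
have fp i : 0 <= i`!%:R :> R by [].
have -> : (2 * n - m)`!%:R * ((2 * s ^+ 2) ^+ m / (2 * s ^+ 2) ^+ j) /
   (j`!%:R * p`!%:R * m`!%:R * ((2 * c ^+ 2) ^+ p / (2 * c ^+ 2) ^+ m)) =
  (m`!%:R * (2 * n - m)`!%:R / (j`!%:R * p`!%:R)) *
  ((2 * c * s) ^+ m / (2 ^+ n * s ^+ j * c ^+ p * m`!%:R)) ^+ 2.
  have e : 2 ^+ n * 2 ^+ n = 2 ^+ j * 2 ^+ p :> R by rewrite -!exprD; congr (_ ^+ _); rewrite /p; lia.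
  have x1 : 2 ^+ n != 0 :> R by rewrite expf_neq0 ?pnatr_eq0.
  have x2 : 2 ^+ j != 0 :> R by rewrite expf_neq0 ?pnatr_eq0.
  have x3 : 2 ^+ p != 0 :> R by rewrite expf_neq0 ?pnatr_eq0.
  have x4 : 2 ^+ m != 0 :> R by rewrite expf_neq0 ?pnatr_eq0.
  have x5 : c ^+ p != 0 by rewrite expf_neq0.
  have x6 : s ^+ j != 0 by rewrite expf_neq0.
  have x7 : c ^+ m != 0 by rewrite expf_neq0.
  have x8 : s ^+ m != 0 by rewrite expf_neq0.
  rewrite !(exprMn _ 2 (s ^+ 2)) !(exprMn _ 2 (c ^+ 2)) (exprMn _ (2 * c) s) (exprMn _ 2 c).
  rewrite (exprAC s 2 m) (exprAC s 2 j) (exprAC c 2 p) (exprAC c 2 m).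
  move: (fn m) (fn j) (fn p) (fn (2 * n - m)%N).
  move: e x1 x2 x3 x4 x5 x6 x7 x8.
  move: (2 ^+ n : R) (2 ^+ j : R) (2 ^+ p : R) (2 ^+ m : R) (c ^+ p) (s ^+ j) (c ^+ m) (s ^+ m).
  move: (m`!%:R : R) (j`!%:R : R) (p`!%:R : R) ((2 * n - m)`!%:R : R).
  move=> f1 f2 f3 f4 X J P M cp sj cm sm e x1 x2 x3 x4 x5 x6 x7 x8 y1 y2 y3 y4.
  rewrite expr_div_n (_ : (X * sj * cp * f1) ^+ 2 = J * P * (sj * cp * f1) ^+ 2).
    by field; rewrite x2 x3 x4 x5 x6 x7 y1 y2 y3.
  by rewrite -e; ring.
rewrite sqrt_sqr_mul; last first.
  by rewrite divr_ge0// ?mulr_ge0// exprn_ge0// ?mulr_ge0// ltW.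
rewrite -/(wignorm n m j).
have e : 2 ^+ n * 2 ^+ n = 2 ^+ j * 2 ^+ p :> R by rewrite -!exprD; congr (_ ^+ _); rewrite /p; lia.
have x1 : 2 ^+ n != 0 :> R by rewrite expf_neq0 ?pnatr_eq0.
have x5 : c ^+ p != 0 by rewrite expf_neq0.
have x6 : s ^+ j != 0 by rewrite expf_neq0.
have x7 : (2 * c * s) ^+ m != 0 by rewrite expf_neq0// !mulf_neq0// pnatr_eq0.
have sg : (-1) ^+ j * (-1) ^+ j = 1 :> R by rewrite -expr2 sqrr_sign.
rewrite !(exprMn _ 2 c) !(exprMn _ 2 s); move: (fn m) e x1 x5 x6 x7 sg.
move: (m`!%:R : R) ((2 * c * s) ^+ m) (2 ^+ n : R) (2 ^+ j : R) (2 ^+ p : R) (c ^+ p) (s ^+ j) ((-1) ^+ j : R) (wignorm n m j) (rotpoly c s p j)`_m.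
move=> f A X J P cp sj g W r hf e x1 x5 x6 x7 sg.
transitivity ((g * g) * ((J * P) / (X * X)) * (W * r)).
  by field; rewrite x1 x5 x6 x7 hf.
by rewrite sg -e divff ?mulf_neq0// !mul1r.
Qed.

Lemma continuous_coefM (P Q : R -> {poly R}) :
  (forall m, continuous (fun x => (P x)`_m)) -> (forall m, continuous (fun x => (Q x)`_m)) ->
  forall m, continuous (fun x => (P x * Q x)`_m).
Proof.
move=> cP cQ m.
have -> : (fun x => (P x * Q x)`_m) = (fun x => \sum_(i < m.+1) (P x)`_i * (Q x)`_(m - i)).
  by apply/funext => y; rewrite coefM.
apply: continuous_bigsum => i x.
by apply: cvgM; [exact: cP|exact: cQ].
Qed.

Lemma continuous_rotpoly (f g : R -> R) p q m : continuous f -> continuous g ->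
  continuous (fun x => (rotpoly (f x) (g x) p q)`_m).
Proof.
move=> cf cg.
have cE (P : R -> {poly R}) n : (forall m, continuous (fun x => (P x)`_m)) ->
    forall m, continuous (fun x => (P x ^+ n)`_m).
  move=> cP; elim: n => [|n IH] k.
    exact: (@cst_continuous _ _ ((1 : {poly R})`_k)).
  have -> : (fun x => (P x ^+ n.+1)`_k) = (fun x => (P x * P x ^+ n)`_k).
    by apply/funext => x; rewrite exprS.
  exact: continuous_coefM.
have z : continuous (fun _ : R => 0 : R) by exact: cst_continuous.
apply: continuous_coefM => k; apply: cE => {}k.
  have -> : (fun x => ((f x)%:P + (g x)%:P * 'X)`_k) =
     (if k is k'.+1 then (if k' is 0%N then g else fun=> 0) else f).
    apply/funext => x; rewrite coefD coefMX !coefC.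
    by case: k => [|[|k]] /=; rewrite ?addr0 ?add0r// coefC.
  by case: k => [|[|k]].
have -> : (fun x => ((f x)%:P * 'X - (g x)%:P)`_k) =
   (if k is k'.+1 then (if k' is 0%N then f else fun=> 0) else fun x => - g x).
  apply/funext => x; rewrite coefB coefMX !coefC.
  by case: k => [|[|k]] /=; rewrite ?subr0 ?sub0r// coefC.
case: k => [|[|k]] //.
by move=> x; apply: cvgN; exact: cg.
Qed.

(** Written through the square roots of (1 + t)/2 and (1 - t)/2, the coefficient
    is continuous on the whole line, hence it gives the limits at the end points
    as well. *)
Lemma wigner_dE n m j (b : R) : 0 <= b <= pi -> (m <= 2 * n)%N -> (j <= 2 * n)%N ->
  wigner_d n (n%:Z - m%:Z) (n%:Z - j%:Z) (cos b) = wignorm n m j * (rotang (2 * n - j) j b)`_m.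
Proof.
move=> /andP[b0 bp] lem lej.
pose W (t : R) := wignorm n m j *
  (rotpoly (Num.sqrt ((1 + t) / 2)) (Num.sqrt ((1 - t) / 2)) (2 * n - j) j)`_m.
have cW : continuous W.
  have ch (e : R) : continuous (fun t : R => Num.sqrt ((1 + e * t) / 2)).
    move=> t; apply: (@continuous_comp _ _ _ (fun t : R => (1 + e * t) / 2) Num.sqrt); last exact: sqrt_continuous.
    apply: cvgM; last exact: cvg_cst.
    apply: cvgD; first exact: cvg_cst.
    by apply: cvgM; [exact: cvg_cst|exact: cvg_id].
  have c1 : continuous (fun t : R => Num.sqrt ((1 + t) / 2)).
    have -> : (fun t : R => Num.sqrt ((1 + t) / 2)) = (fun t => Num.sqrt ((1 + 1 * t) / 2)).
      by apply/funext => t; rewrite mul1r.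
    exact: ch.
  have c2 : continuous (fun t : R => Num.sqrt ((1 - t) / 2)).
    have -> : (fun t : R => Num.sqrt ((1 - t) / 2)) = (fun t => Num.sqrt ((1 + (-1) * t) / 2)).
      by apply/funext => t; rewrite mulN1r.
    exact: ch.
  move=> t; apply: cvgM; first exact: cvg_cst.
  exact: (@continuous_rotpoly _ _ (2 * n - j) j m c1 c2 t).
have WE t : -1 < t < 1 -> wigner_d_formula n (n%:Z - m%:Z) (n%:Z - j%:Z) t = W t.
  move=> /andP[t1 t2].
  have p1 : 0 < (1 + t) / 2 by rewrite divr_gt0//; lra.
  have p2 : 0 < (1 - t) / 2 by rewrite divr_gt0//; lra.
  rewrite /W -wigner_formulaE// ?sqrtr_gt0// !sqr_sqrtr ?ltW//; last by field.
  by congr wigner_d_formula; field.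
have -> : wignorm n m j * (rotang (2 * n - j) j b)`_m = W (cos b).
  have [c0 s0] : 0 <= cos (b / 2) /\ 0 <= sin (b / 2).
    split; [apply: cos_ge0_pihalf|apply: sin_ge0_pi]; lra.
  have cs := cos2Dsin2 (b / 2).
  rewrite /W /rotang (cos_half b); congr (_ * (rotpoly _ _ _ _)`_m).
    rewrite (_ : (1 + _) / 2 = cos (b / 2) ^+ 2) ?sqrtr_sqr ?ger0_norm//.
    by lra.
  rewrite (_ : (1 - _) / 2 = sin (b / 2) ^+ 2) ?sqrtr_sqr ?ger0_norm//.
  by lra.
rewrite /wigner_d; case: eqP => [->|/eqP n1].
  apply/cvg_lim; first exact: Rhausdorff.
  apply: cvg_trans; last exact: (cvg_at_left_filter (cW 1)).
  apply: near_eq_cvg; near=> t; rewrite WE//; apply/andP; split; near: t.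
    by apply: nbhs_left_gt; lra.
  exact: nbhs_left_lt.
case: eqP => [->|/eqP n2].
  apply/cvg_lim; first exact: Rhausdorff.
  apply: cvg_trans; last exact: (cvg_at_right_filter (cW (-1))).
  apply: near_eq_cvg; near=> t; rewrite WE//; apply/andP; split; near: t.
    exact: nbhs_right_gt.
  by apply: nbhs_right_lt; lra.
by apply: WE; rewrite !lt_neqAle n1 eq_sym n2 cos_geN1 cos_le1.
Unshelve. all: end_near.
Qed.

End Wigner.

(** * The numbers lambda as meridian integrals *)

Section Lambda.
Context {R : realType}.

Lemma dfact_even a : dfact (2 * a) = (2 ^ a * a`!)%N.
Proof.
elim: a => [|a IH] //; rewrite mulnS /= IH factS expnS; lia.
Qed.

Lemma fact_dfact n : n.+1`! = (dfact n.+1 * dfact n)%N.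
Proof.
elim: n => [|n IH] //; rewrite factS IH.
by rewrite (_ : dfact n.+2 = n.+2 * dfact n)%N//; lia.
Qed.

Lemma lambda_posE n a : (0 < n)%N -> (2 * a < n)%N ->
  lambda_pos n (n - 2 * a) = (4 * pi)^-1 * sphnorm n (2 * a) * meridian n (2 * a) :> R.
Proof.
move=> n0 lt; rewrite meridian_even ?(ltnW lt)// /lambda_pos.
have fn i : i`!%:R != 0 :> R by rewrite pnatr_eq0 -lt0n fact_gt0.
have fp i : 0 <= i`!%:R :> R by [].
have -> : (n - (n - 2 * a) = 2 * a)%N by lia.
have -> : (n + (n - 2 * a) = 2 * (n - a))%N by lia.
have ->: sphnorm n (2 * a) = Num.sqrt ((2 * n%:R + 1) / (4 * pi) * ((2 * a)`!%:R / (2 * (n - a))`!%:R)) *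
   ((2 * (n - a))`!%:R / n`!%:R) :> R.
  rewrite -sqrt_sqr_mul ?divr_ge0// /sphnorm.
  have -> : (2 * n - 2 * a = 2 * (n - a))%N by lia.
  congr Num.sqrt; rewrite -!mulrA; congr (_ * (_ * _)).
  by move: (fn (2 * a)%N) (fn (2 * (n - a))%N) (fn n); move: ((2 * a)`!%:R : R) ((2 * (n - a))`!%:R : R) (n`!%:R : R) => x y z hx hy hz; field; rewrite hy hz.
have -> : (-1) ^+ (n - 2 * a) = (-1) ^+ n :> R.
  have -> : (-1) ^+ n = (-1) ^+ (n - 2 * a + 2 * a) :> R by congr (_ ^+ _); lia.
  by rewrite exprD (exprM _ 2) sqrrN !expr1n mulr1.
have k : (2 * (n - a))`!%:R = (2 ^+ (n - a) * (n - a)`!%:R) * (dfact (2 * (n - a) - 1))%:R :> R.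
  have -> : (2 * (n - a) = (2 * (n - a) - 1).+1)%N by lia.
  rewrite fact_dfact natrM; congr (_ * _); last by congr (_%:R); congr dfact; lia.
  have -> : (2 * (n - a) - 1).+1 = (2 * (n - a))%N by lia.
  by rewrite dfact_even natrM natrX.
have b3 : 'C(n, a)%:R = n`!%:R / (a`!%:R * (n - a)`!%:R) :> R.
  have la : (a <= n)%N by lia.
  by rewrite -(bin_fact la) !natrM; field; rewrite !fn.
rewrite dfact_even addn1 /meridian_scale b3.
set S := Num.sqrt _; rewrite k.
rewrite !natrM natrX natrB; last by lia.
have e : 2 ^+ n = 2 ^+ a * 2 ^+ (n - a) :> R by rewrite -exprD; congr (_ ^+ _); lia.
rewrite e.
have : 2 ^+ a != 0 :> R by rewrite expf_neq0 ?pnatr_eq0.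
have : 2 ^+ (n - a) != 0 :> R by rewrite expf_neq0 ?pnatr_eq0.
have : (dfact n.+1)%:R != 0 :> R by rewrite pnatr_eq0 -lt0n dfact_gt0.
have := pi_gt0 R; rewrite lt0r => /andP[].
move: (fn n) (fn a) (fn (n - a)%N).
rewrite !natrM; move: (pi : R) (n`!%:R : R) (a`!%:R : R) ((n - a)`!%:R : R) => p f1 f2 f3.
move: ((dfact n.+1)%:R : R) (2 ^+ a : R) (2 ^+ (n - a) : R) S => d x y S h1 h2 h3 h4 _ h5 h6 h7.
by case: ifP => _; field; rewrite ?h1 ?h2 ?h3 ?h4 ?h5 ?h6 ?h7.
Qed.

Lemma sphnorm_sym n m : (m <= 2 * n)%N -> sphnorm n (2 * n - m) = sphnorm n m :> R.
Proof. by move=> le; rewrite /sphnorm subKn// [(2 * n - m)`!%:R * _]mulrC. Qed.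

Lemma meridian_mid n : (0 < n)%N -> meridian n n = 0 :> R.
Proof.
move=> n0; have [od|ev] := boolP (odd n).
  have -> : n = (2 * n./2).+1 :> nat by have := odd_double_half n; lia.
  rewrite meridian_odd//; lia.
have e : n = (2 * n./2)%N by have := odd_double_half n; lia.
rewrite {2}e meridian_even//; last by lia.
by rewrite {2}e natrM subrr mulr0 !mul0r.
Qed.

Lemma lambda0 : lambda 0 0 = (4 * pi)^-1 * sphnorm 0 0 * meridian 0 0 :> R.
Proof.
rewrite /lambda /= meridian0 /= expr0 divr1 !mul1r /sphnorm /= muln0 sub0n fact0.
rewrite mulr0 add0r expr1n !mulr1 divr1 mulr1 div1r.
have p0 : 0 < 4 * pi :> R by rewrite mulr_gt0 ?pi_gt0.
have -> : (3 / 2 : R) = 1 + 2^-1 by field.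
rewrite powRN powRD; last by rewrite gt_eqF ?implybT.
rewrite powRr1 ?ltW// powR12_sqrt ?ltW// invfM sqrtrV ?ltW//.
by rewrite mulrC.
Qed.

(** Odd indices, the middle index and negative orders are settled by parity,
    by the vanishing middle value and by the symmetry of the meridian
    integrals. *)
Lemma lambdaE n j : (j <= 2 * n)%N ->
  lambda n (n%:Z - j%:Z) = (4 * pi)^-1 * sphnorm n j * meridian n j :> R.
Proof.
case: n => [|n] le.
  by have -> : j = 0%N; [lia|exact: lambda0].
set N := n.+1 in le *.
have [od|ev] := boolP (odd j).
  have e : j = (2 * j./2).+1 by have := odd_double_half j; lia.
  rewrite e meridian_odd; last by lia.
  rewrite -e mulr0 /lambda.
  rewrite [N == 0%N]/= andFb ifF//; apply/negbTE; rewrite negb_and negbK; apply/orP; right.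
  have : odd (N + `|N%:Z - j%:Z|) = odd j.
    have [l|l] := leqP j N.
      have -> : (N + `|N%:Z - j%:Z| = 2 * (N - j) + j)%N by lia.
      by rewrite oddD oddM.
    by have -> : (N + `|N%:Z - j%:Z| = j)%N by lia.
  by move=> ->.
have e : j = (2 * j./2)%N by have := odd_double_half j; lia.
have ev' k : (k <= N)%N -> ~~ odd k -> ~~ odd (N + (N - k)).
  move=> lk ek; have : (N + (N - k) + k = 2 * N)%N by lia.
  by move=> /(congr1 odd); rewrite oddD oddM /= (negbTE ek) addbF => ->.
have [lt|gt|eq] := ltngtP j N.
- have kE : n.+1%:Z - j%:Z = (N - j)%N%:Z by rewrite /N; lia.
  rewrite /lambda kE [n.+1 == 0%N]/= andFb absz_nat.
  have -> : (0 < N - j <= n.+1)%N by rewrite -/N; lia.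
  rewrite -/N ev' ?(ltnW lt)//=.
  have -> : (0 < (N - j)%N%:Z) by lia.
  by rewrite e lambda_posE// -e.
- pose j' := (2 * N - j)%N.
  have e' : j' = (2 * j'./2)%N.
    have : ~~ odd j' by rewrite /j' oddB// oddM /= (negbTE ev).
    by move=> h; have := odd_double_half j'; lia.
  have jE : j = (2 * N - j')%N by rewrite /j'; lia.
  have kE : `|N%:Z - j%:Z|%N = (N - j')%N by rewrite /j'; lia.
  rewrite /lambda kE /=.
  have -> : (0 < N - j' <= n.+1)%N by rewrite /j' /N in gt le *; lia.
  have ej' : ~~ odd j' by rewrite /j' oddB// oddM /= (negbTE ev).
  rewrite -/N ev' //; last by rewrite /j'; lia.
  have -> : (0 < N%:Z - j%:Z) = false by lia.
  rewrite /= {1 2}e' lambda_posE//; last by rewrite -e' /j'; lia.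
  rewrite -e' jE sphnorm_sym; last by rewrite /j'; lia.
  rewrite meridian_sym; last by rewrite /j'; lia.
  have -> : (-1) ^+ (N - j') = (-1) ^+ (N + j') :> R.
    have -> : (N + j' = N - j' + 2 * j')%N by rewrite /j'; lia.
    by rewrite exprD exprM sqrrN !expr1n mulr1.
  ring.
- by rewrite eq meridian_mid// mulr0 /lambda subrr /=.
Qed.

End Lambda.

(** * The transform in Euler angles *)

Section Transform.
Context {R : realType}.
Notation mu := (@lebesgue_measure R).

Lemma Re_realM (z : R[i]) (x : R) : complex.Re (z * x%:C) = complex.Re z * x.
Proof. by case: z => u v /=; rewrite mulr0 subr0. Qed.

Lemma Im_realM (z : R[i]) (x : R) : complex.Im (z * x%:C) = complex.Im z * x.
Proof. by case: z => u v /=; rewrite mulr0 add0r. Qed.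

Lemma conj_real (x : R) : (x%:C : R[i])^* = x%:C.
Proof. exact: conjc_real. Qed.

Lemma Re_sum (I : Type) (r : seq I) (F : I -> R[i]) :
  complex.Re (\sum_(i <- r) F i) = \sum_(i <- r) complex.Re (F i).
Proof. by rewrite (big_morph (@complex.Re R) (id1 := 0) (op1 := +%R))// => -[? ?] [? ?]. Qed.

Lemma Im_sum (I : Type) (r : seq I) (F : I -> R[i]) :
  complex.Im (\sum_(i <- r) F i) = \sum_(i <- r) complex.Im (F i).
Proof. by rewrite (big_morph (@complex.Im R) (id1 := 0) (op1 := +%R))// => -[? ?] [? ?]. Qed.

Lemma cintegral_sum n (K : 'I_n -> R[i]) (r : 'I_n -> R -> R) (a b : R) :
  (forall j, continuous (r j)) ->
  cintegral `[a, b] (fun t => \sum_j K j * (r j t)%:C) =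
  \sum_j K j * (\int[mu]_(t in `[a, b]) r j t)%:C.
Proof.
move=> cr; rewrite /cintegral; apply/eqP; rewrite eq_complex /=; apply/andP; split; apply/eqP.
  rewrite Re_sum; under eq_Rintegral do rewrite Re_sum.
  rewrite Rintegral_sum; last first.
    by move=> j; under eq_fun do rewrite Re_realM; exact: continuous_scale.
  apply: eq_bigr => j _; rewrite Re_realM -RintegralZ//.
  by apply: eq_Rintegral => t _; rewrite Re_realM.
rewrite Im_sum; under eq_Rintegral do rewrite Im_sum.
rewrite Rintegral_sum; last first.
  by move=> j; under eq_fun do rewrite Im_realM; exact: continuous_scale.
apply: eq_bigr => j _; rewrite Im_realM -RintegralZ//.
by apply: eq_Rintegral => t _; rewrite Im_realM.
Qed.

(** The product of lambda and [wignorm], see [sphnorm_wignorm]. *)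
Definition transform_coef (n m j : nat) : R := (4 * pi)^-1 * sphnorm n m * meridian n j.

(** Both rotations R3 only produce exponential factors, and the expansion under
    R2 leaves the meridian integrals. *)
Lemma semicircle_Psi n m a b c : (m <= 2 * n)%N ->
  semicircle (@Ynk R n (n%:Z - m%:Z)) (Psi a b c) =
  \sum_(j < (2 * n).+1) (transform_coef n m j)%:C * ((rotang (2 * n - j) j b)`_m)%:C *
     expi ((n%:Z - m%:Z)%:~R * a) * expi ((n%:Z - j%:Z)%:~R * c).
Proof.
move=> le; rewrite /semicircle.
pose K (j : 'I_(2 * n).+1) := (sphnorm n m)%:C * expi ((n%:Z - m%:Z)%:~R * a) *
  expi ((n%:Z - j%:Z)%:~R * c) * ((rotang (2 * n - j) j b)`_m)%:C.
have -> : (fun t => Ynk n (n%:Z - m%:Z) (Psi a b c *m Phi 0 t) * (sin t)%:C) =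
   (fun t => \sum_(j < (2 * n).+1) K j * ((rotang n n t)`_j * sin t)%:C).
  apply/funext => t.
  have [x [y [z hv]]] := vec3_ex (Psi a b c *m Phi 0 t).
  have h1 : x ^+ 2 + y ^+ 2 + z ^+ 2 = 1.
    rewrite (SO3_unit (SO3_Psi a b c) (x := cos 0 * sin t) (y := sin 0 * sin t) (z := cos t) hv).
    by rewrite cos0 sin0 mul1r mul0r expr0n addr0 addrC cos2Dsin2.
  rewrite hv YnkE// -hv /Psi -!mulmxA null_form_R3// null_form_R2.
  rewrite !(mulr_sumr, mulr_suml); apply: eq_bigr => j _.
  rewrite null_form_R3; last by rewrite -ltnS.
  rewrite null_form_meridian /K rmorphM /=; ring.
rewrite cintegral_sum; last first.
  by move=> j t; apply: cvgM; [exact: continuous_rot|exact: continuous_sin].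
rewrite mulr_sumr; apply: eq_bigr => j _.
rewrite /K /transform_coef -/(meridian n j) !rmorphM /=; ring.
Qed.

Lemma sphnorm_wignorm n m j : (m <= 2 * n)%N -> (j <= 2 * n)%N ->
  sphnorm n j * wignorm n m j = sphnorm n m :> R.
Proof.
move=> lem lej; rewrite /sphnorm /wignorm -sqrtrM; last first.
  apply: mulr_ge0; apply: divr_ge0; [by rewrite addr_ge0 ?mulr_ge0|exact: mulr_ge0 (pi_ge0 R)|exact: mulr_ge0|exact: exprn_ge0].
congr Num.sqrt.
have fn i : i`!%:R != 0 :> R by rewrite pnatr_eq0 -lt0n fact_gt0.
have := pi_gt0 R; rewrite lt0r => /andP[h0 _].
move: (fn n) (fn m) (fn j) (fn (2 * n - m)%N) (fn (2 * n - j)%N) h0.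
move: (n`!%:R : R) (m`!%:R : R) (j`!%:R : R) ((2 * n - m)`!%:R : R) ((2 * n - j)`!%:R : R) (pi : R).
by move=> x y z u v p h1 h2 h3 h4 h5 h6; field; rewrite h1 h3 h5 h6.
Qed.

Lemma semicircle_wigner n m (Q : 'M[R]_3) : SO3 Q -> (m <= 2 * n)%N ->
  semicircle (@Ynk R n (n%:Z - m%:Z)) Q =
  \sum_(i < (2 * n).+1)
    let j := i%:Z - n%:Z in (lambda n j)%:C * (wignerD n (n%:Z - m%:Z) j Q)^*.
Proof.
move=> hQ le; have := euler_anglesP hQ; rewrite /wignerD.
case: (euler_angles Q) => [[a b] c] /= [aB bB cB <-].
rewrite semicircle_Psi// [RHS](reindex_inj rev_ord_inj) /=; apply: eq_bigr => j _.
have lej : (j <= 2 * n)%N by rewrite -ltnS.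
have -> : ((2 * n).+1 - j.+1 = 2 * n - j)%N by rewrite subSS.
have -> : (2 * n - j)%N%:Z - n%:Z = n%:Z - j%:Z by lia.
rewrite lambdaE// wigner_dE// !rmorphM /= -!expiN !opprK.
rewrite !conj_real.
rewrite /transform_coef -(sphnorm_wignorm le lej) !rmorphM /=; ring.
Qed.

End Transform.

(** * Integration of trigonometric sums over the rotations *)

Section TripleIntegral.
Context {R : realType}.
Notation mu := (@lebesgue_measure R).

Lemma EFin_integral (f : R -> R) a b : continuous f ->
  (\int[mu]_(x in `[a, b]) (f x)%:E = (\int[mu]_(x in `[a, b]) f x)%:E)%E.
Proof.
move=> cf; rewrite /Rintegral fineK//; apply: integrable_fin_num => //.
exact: integrable_segment.
Qed.

Lemma expi_2pi (p : int) : expi (p%:~R * (2 * pi)) = 1 :> R[i].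
Proof.
have h : expi (2 * pi) = 1 :> R[i].
  by rewrite mulr_natl /expi -[pi *+ 2]add0r cosD2pi sinD2pi cos0 sin0.
case: p => k; first by rewrite -pmulrn -expiX h expr1n.
by rewrite NegzE mulrNz mulNr expiN -pmulrn -expiX h expr1n rmorph1.
Qed.

Lemma continuous_trig (p u v : R) : continuous (fun a : R => u * cos (p * a) - v * sin (p * a)).
Proof.
have cp : continuous (fun a : R => p * a) by apply: (@continuous_scale _ p id) => a; exact: cvg_id.
apply: continuous_lincomb.
  by move=> a; apply: (@continuous_comp _ _ _ (fun a => p * a) cos); [exact: cp|exact: continuous_cos].
by move=> a; apply: (@continuous_comp _ _ _ (fun a => p * a) sin); [exact: cp|exact: continuous_sin].
Qed.

Lemma integral_trig (p : int) (u v : R) :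
  \int[mu]_(a in `[0, 2 * pi]) (u * cos (p%:~R * a) - v * sin (p%:~R * a)) =
  2 * pi * (p == 0)%:R * u.
Proof.
have p2 : 0 < 2 * pi :> R by rewrite mulr_gt0 ?pi_gt0.
have [->|p0] := eqVneq p 0.
  under eq_Rintegral do rewrite mul0r cos0 sin0 mulr1 mulr0 subr0.
  rewrite Rintegral_cst//= lebesgue_measure_itv /= lte_fin p2 /= subr0.
  by rewrite mulr1 mulrC.
have pN : p%:~R != 0 :> R by rewrite intr_eq0.
have dp (a : R) : is_derive a 1 (fun a : R => p%:~R * a) p%:~R.
  apply: (is_derive_eq (is_deriveZ p%:~R (is_derive_id a 1))).
  by rewrite /GRing.scale /= mulr1.
have dF (a : R) : is_derive a 1
    (fun a : R => (u / p%:~R) * sin (p%:~R * a) + (v / p%:~R) * cos (p%:~R * a))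
    (u * cos (p%:~R * a) - v * sin (p%:~R * a)).
  have d1 := @is_derive1_comp _ sin (fun a => p%:~R * a) a _ _ (is_derive_sin _) (dp a).
  have d2 := @is_derive1_comp _ cos (fun a => p%:~R * a) a _ _ (is_derive_cos _) (dp a).
  apply: (is_derive_eq (is_deriveD (is_deriveZ (u / p%:~R) d1) (is_deriveZ (v / p%:~R) d2))).
  by rewrite /GRing.scale /=; field.
rewrite (integral_is_derive p2 (@continuous_trig _ _ _) dF).
have := expi_2pi p; rewrite /expi => -[-> ->].
by rewrite !mulr0 cos0 sin0 mulr0 subrr mul0r.
Qed.

(** The iterated integral is evaluated from the inside: each step leaves a finite
    sum of products of functions of one angle. *)
Lemma integralSO3_trig (I : finType) (f : 'M[R]_3 -> R[i]) (K : I -> R[i])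
    (B : I -> R -> R) (p r : I -> int) : (forall i, continuous (B i)) ->
  (forall a b c, f (Psi a b c) = \sum_i K i * (B i b)%:C *
     expi ((p i)%:~R * a) * expi ((r i)%:~R * c)) ->
  integralSO3 (fun Q => (complex.Re (f Q))%:E) =
  (\sum_i complex.Re (K i) * (2 * pi * (p i == 0)%:R) * (2 * pi * (r i == 0)%:R) *
    \int[mu]_(b in `[0, pi]) (B i b * sin b))%:E.
Proof.
move=> cB fE; rewrite /integralSO3.
have ReE (k : R[i]) x y : complex.Re (k * x%:C * expi y) =
    x * (complex.Re k * cos y - complex.Im k * sin y).
  by case: k => u v; rewrite /expi /= !mulr0 subr0 add0r; ring.
pose L i c := complex.Re (K i) * cos ((r i)%:~R * c) - complex.Im (K i) * sin ((r i)%:~R * c).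
have cBs i : continuous (fun b : R => B i b * sin b).
  by move=> b; apply: cvgM; [exact: cB|exact: continuous_sin].
transitivity (\int[mu]_(c in `[0%R, (2 * pi)%R]) \int[mu]_(b in `[0%R, pi])
   (\sum_i (2 * pi * (p i == 0)%:R * L i c) * (B i b * sin b))%:E)%E.
  apply: eq_integral => c _; apply: eq_integral => b _.
  transitivity (\int[mu]_(a in `[0%R, (2 * pi)%R])
     (\sum_i (B i b * sin b) *
       (complex.Re (K i * expi ((r i)%:~R * c)) * cos ((p i)%:~R * a) -
        complex.Im (K i * expi ((r i)%:~R * c)) * sin ((p i)%:~R * a)))%:E)%E.
    apply: eq_integral => a _; rewrite -EFinM fE Re_sum mulr_suml; congr (_%:E).
    apply: eq_bigr => i _; rewrite -mulrA (mulrC (expi _)) mulrA [K i * _]mulrC -(mulrA (B i b)%:C).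
    by rewrite (mulrC (B i b)%:C) ReE; ring.
  rewrite EFin_integral; last first.
    by apply: continuous_bigsum => i; exact/continuous_scale/continuous_trig.
  rewrite Rintegral_sum; last by move=> i; exact/continuous_scale/continuous_trig.
  congr (_%:E); apply: eq_bigr => i _; rewrite RintegralZ; last exact: continuous_trig.
  rewrite integral_trig /L.
  have -> : complex.Re (K i * expi ((r i)%:~R * c)) =
      complex.Re (K i) * cos ((r i)%:~R * c) - complex.Im (K i) * sin ((r i)%:~R * c).
    by case: (K i).
  ring.
transitivity (\int[mu]_(c in `[0%R, (2 * pi)%R])
   (\sum_i (2 * pi * (p i == 0)%:R * \int[mu]_(b in `[0, pi]) (B i b * sin b)) * L i c)%:E)%E.
  apply: eq_integral => c _; rewrite EFin_integral; last first.
    by apply: continuous_bigsum => i; exact: continuous_scale.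
  rewrite Rintegral_sum; last by move=> i; exact: continuous_scale.
  by congr (_%:E); apply: eq_bigr => i _; rewrite RintegralZ//; ring.
rewrite EFin_integral; last by apply: continuous_bigsum => i; exact/continuous_scale/continuous_trig.
rewrite Rintegral_sum; last by move=> i; exact/continuous_scale/continuous_trig.
congr (_%:E); apply: eq_bigr => i _; rewrite RintegralZ; last exact: continuous_trig.
by rewrite integral_trig; ring.
Qed.

End TripleIntegral.

(** * Inner products and the theorem *)

Section InnerProducts.
Context {R : realType}.
Notation mu := (@lebesgue_measure R).

Lemma normc_sqr (z : R[i]) : Normc.normc z ^+ 2 = complex.Re (z * z^*).
Proof.
case: z => a b /=; rewrite sqr_sqrtr ?addr_ge0 ?sqr_ge0//.
by rewrite mulrN opprK !expr2.
Qed.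

Lemma rot_orthogonal_order n1 n2 m1 m2 j1 j2 :
  (m1 <= 2 * n1)%N -> (m2 <= 2 * n2)%N -> (j1 <= 2 * n1)%N -> (j2 <= 2 * n2)%N ->
  (n1 + m2 = n2 + m1)%N -> (n1 + j2 = n2 + j1)%N -> n1 != n2 ->
  \int[mu]_(b in `[0, pi]) ((rotang (2 * n1 - j1) j1 b)`_m1 * (rotang (2 * n2 - j2) j2 b)`_m2 * sin b) = 0.
Proof.
move=> lm1 lm2 lj1 lj2 hm hj; wlog lt : n1 n2 m1 m2 j1 j2 lm1 lm2 lj1 lj2 hm hj / (n1 < n2)%N.
  move=> W ne; have [lt|gt|eq] := ltngtP n1 n2; last by rewrite eq eqxx in ne.
    exact: W.
  under eq_Rintegral do rewrite (mulrC (_`_m1)).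
  by apply: W => //; rewrite eq_sym.
move=> _; pose d := (n2 - n1)%N.
have -> : m2 = (m1 + d)%N by rewrite /d; lia.
have -> : (2 * n2 - j2 = 2 * n1 - j1 + d)%N by rewrite /d; lia.
have -> : j2 = (j1 + d)%N by rewrite /d; lia.
by apply: rot_orthogonal; rewrite /d subn_gt0.
Qed.

(** The dependence on m cancels here: this is why the singular values do not
    depend on the order. *)
Lemma sphnorm_rotang n m j : (m <= 2 * n)%N -> (j <= 2 * n)%N ->
  sphnorm n m ^+ 2 * \int[mu]_(b in `[0, pi]) ((rotang (2 * n - j) j b)`_m ^+ 2 * sin b) =
  (2 * pi)^-1 * (j`!%:R * (2 * n - j)`!%:R / n`!%:R ^+ 2).
Proof.
move=> lm lj; rewrite rot_norm_binomial rot_beta subnK//.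
have fn i : i`!%:R != 0 :> R by rewrite pnatr_eq0 -lt0n fact_gt0.
rewrite /sphnorm sqr_sqrtr; last first.
  apply: mulr_ge0; apply: divr_ge0; [by rewrite addr_ge0 ?mulr_ge0|exact: mulr_ge0 (pi_ge0 R)|exact: mulr_ge0|exact: exprn_ge0].
have b3 : 'C(2 * n, m)%:R = (2 * n)`!%:R / (m`!%:R * (2 * n - m)`!%:R) :> R.
  by rewrite -(bin_fact lm) !natrM; field; rewrite !fn.
rewrite b3 factS (natrM _ (2 * n).+1) -(@natr1 _ (2 * n)) natrM.
have := pi_gt0 R; rewrite lt0r => /andP[h0 _].
have x1 : 2 * n%:R + 1 != 0 :> R by rewrite -natrM natr1 pnatr_eq0.
move: (fn n) (fn m) (fn (2 * n)%N) (fn (2 * n - m)%N) h0.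
move: (n`!%:R : R) (m`!%:R : R) ((2 * n)`!%:R : R) ((2 * n - m)`!%:R : R) (pi : R).
by move=> x y z u p h1 h2 h3 h4 h6; field; rewrite x1 h1 h2 h3 h4 h6.
Qed.

(** The factor kappa allows for the normalisation of Z and, as - i, for imaginary
    parts. *)
Lemma transform_dot (kappa : R[i]) (f : 'M[R]_3 -> R[i]) n1 n2 m1 m2 :
  (m1 <= 2 * n1)%N -> (m2 <= 2 * n2)%N ->
  (forall a b c, f (Psi a b c) = kappa *
     semicircle (Ynk n1 (n1%:Z - m1%:Z)) (Psi a b c) *
     (semicircle (Ynk n2 (n2%:Z - m2%:Z)) (Psi a b c))^*) ->
  integralSO3 (fun Q => (complex.Re (f Q))%:E) =
  (complex.Re kappa * (((n1 == n2) && (n1%:Z - m1%:Z == n2%:Z - m2%:Z))%:R *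
     (meridian_norm n1 / (8 * pi))))%:E.
Proof.
move=> le1 le2 fE.
pose J := ('I_(2 * n1).+1 * 'I_(2 * n2).+1)%type.
pose K (q : J) : R[i] := kappa * (transform_coef n1 m1 q.1 * transform_coef n2 m2 q.2)%:C.
pose B (q : J) (b : R) := (rotang (2 * n1 - q.1) q.1 b)`_m1 * (rotang (2 * n2 - q.2) q.2 b)`_m2.
pose p (q : J) : int := (n1%:Z - m1%:Z) - (n2%:Z - m2%:Z).
pose r (q : J) : int := (n1%:Z - q.1%:Z) - (n2%:Z - q.2%:Z).
rewrite (@integralSO3_trig _ J f K B p r).
- congr (_%:E); rewrite -(pair_bigA _ (fun j1 j2 => complex.Re (K (j1, j2)) *
    (2 * pi * (p (j1, j2) == 0)%:R) * (2 * pi * (r (j1, j2) == 0)%:R) *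
    \int[mu]_(b in `[0, pi]) (B (j1, j2) b * sin b))) /=.
  have KE j1 j2 : complex.Re (K (j1, j2)) = complex.Re kappa * (transform_coef n1 m1 j1 * transform_coef n2 m2 j2).
    by rewrite /K Re_realM.
  have [en|nn] := eqVneq n1 n2; last first.
    rewrite /= mul0r mulr0 big1// => j1 _; rewrite big1// => j2 _.
    have [p0|pn] := eqVneq (p (j1, j2)) 0; last by rewrite !(mulr0, mul0r).
    have [r0|rn] := eqVneq (r (j1, j2)) 0; last by rewrite !(mulr0, mul0r).
    rewrite /B rot_orthogonal_order ?mulr0//=; try by rewrite -ltnS.
      by move: p0; rewrite /p; lia.
    by move: r0; rewrite /r /=; lia.
  subst n2; rewrite /= /p /= subr_eq0.
  have [em|nm] := eqVneq (n1%:Z - m1%:Z) (n1%:Z - m2%:Z); last first.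
    by rewrite /= mul0r mulr0 big1// => j1 _; rewrite big1// => j2 _; rewrite !(mulr0, mul0r).
  have {em} e : m2 = m1 by lia.
  subst m2; rewrite mul1r /meridian_norm mulr_suml mulr_sumr; apply: eq_bigr => j _.
  rewrite (bigD1 j)//= big1 => [|i ne]; last first.
    have -> : (r (j, i) == 0) = false.
      by apply/negbTE; rewrite /r /= subr_eq0; apply: contra ne => /eqP h; apply/eqP/val_inj => /=; lia.
    by rewrite !(mulr0, mul0r).
  rewrite addr0 KE /r /= subrr eqxx !mulr1 /B /transform_coef.
  have lej : (j <= 2 * n1)%N by rewrite -ltnS.
  under eq_Rintegral do rewrite /= -expr2.
  set X := \int[mu]_(_ in _) _.
  transitivity (complex.Re kappa * (4 * pi)^-1 ^+ 2 * (2 * pi) ^+ 2 * meridian n1 j ^+ 2 * (sphnorm n1 m1 ^+ 2 * X)).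
    ring.
  rewrite sphnorm_rotang//.
  have := pi_gt0 R; rewrite lt0r => /andP[h0 _].
  have fn : n1`!%:R != 0 :> R by rewrite pnatr_eq0 -lt0n fact_gt0.
  move: fn h0; move: (n1`!%:R : R) (j`!%:R : R) ((2 * n1 - j)`!%:R : R) (pi : R) (meridian n1 j) (complex.Re kappa).
  by move=> x y z q u v h1 h2; field; rewrite h1 h2.
- by move=> q b; apply: cvgM; exact: continuous_rot.
- move=> a b c; rewrite fE !semicircle_Psi// rmorph_sum /= -mulrA mulr_suml mulr_sumr.
  rewrite -(pair_bigA _ (fun j1 j2 => K (j1, j2) * (B (j1, j2) b)%:C *
    expi ((p (j1, j2))%:~R * a) * expi ((r (j1, j2))%:~R * c))) /=; apply: eq_bigr => j1 _.
  rewrite mulr_sumr mulr_sumr; apply: eq_bigr => j2 _.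
  have -> : expi ((p (j1, j2))%:~R * a) =
    expi ((n1%:Z - m1%:Z)%:~R * a) * expi (- ((n2%:Z - m2%:Z)%:~R * a)) :> R[i].
    by rewrite -expiD /p intrB mulrBl.
  have -> : expi ((r (j1, j2))%:~R * c) =
    expi ((n1%:Z - j1%:Z)%:~R * c) * expi (- ((n2%:Z - j2%:Z)%:~R * c)) :> R[i].
    by rewrite -expiD /r intrB mulrBl.
  by rewrite !rmorphM /= !conj_real -!expiN /K /B /= !rmorphM /=; ring.
Qed.

Lemma L2norm_semicircle n m : (m <= 2 * n)%N ->
  L2normSO3 (semicircle (@Ynk R n (n%:Z - m%:Z))) = Num.sqrt (meridian_norm n / (8 * pi)).
Proof.
move=> le; rewrite /L2normSO3 /sqnormSO3.
under [X in integralSO3 X]eq_fun do rewrite normc_sqr.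
rewrite (@transform_dot 1 _ n n m m le le); last by move=> a b c; rewrite mul1r.
by rewrite /= !eqxx /= !mul1r.
Qed.

Lemma wE n : w n = Num.sqrt (meridian_norm n / (8 * pi)) :> R.
Proof.
rewrite /w -(@L2norm_semicircle n n); last by lia.
by rewrite subrr.
Qed.

Lemma meridian_norm_gt0 n : 0 < meridian_norm n :> R.
Proof.
have /andP[h _] := @meridian_norm_bounds R n.
have : 0 < n.+1%:R * meridian_norm n :> R by exact: lt_le_trans h.
by rewrite pmulr_rgt0.
Qed.

Lemma w_gt0 n : 0 < w n :> R.
Proof.
rewrite wE sqrtr_gt0 divr_gt0 ?meridian_norm_gt0// mulr_gt0// pi_gt0.
by [].
Qed.

Lemma w_sqr n : w n ^+ 2 = meridian_norm n / (8 * pi) :> R.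
Proof.
rewrite wE sqr_sqrtr// divr_ge0 ?(ltW (meridian_norm_gt0 n))//.
exact: mulr_ge0 (pi_ge0 R).
Qed.

Lemma order_range_ex n k : order_range n k -> exists2 m, (m <= 2 * n)%N & k = n%:Z - m%:Z.
Proof.
by move=> /andP[h1 h2]; exists `|n%:Z - k|%N; lia.
Qed.

Lemma semicircle_Znk n m (Q : 'M[R]_3) : (m <= 2 * n)%N -> SO3 Q ->
  semicircle (Ynk n (n%:Z - m%:Z)) Q = (w n)%:C * Znk n (n%:Z - m%:Z) Q.
Proof.
move=> le hQ; rewrite semicircle_wigner// /Znk mulrA -rmorphM /= divff ?mul1r//.
by rewrite gt_eqF// w_gt0.
Qed.

Lemma Znk_Psi n m a b c : (m <= 2 * n)%N ->
  Znk n (n%:Z - m%:Z) (Psi a b c) =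
  ((w n)^-1)%:C * semicircle (@Ynk R n (n%:Z - m%:Z)) (Psi a b c).
Proof. by move=> le; rewrite /Znk -semicircle_wigner//; exact: SO3_Psi. Qed.

Lemma Znk_dot (kappa : R[i]) (f : 'M[R]_3 -> R[i]) n1 n2 m1 m2 :
  (m1 <= 2 * n1)%N -> (m2 <= 2 * n2)%N ->
  (forall a b c, f (Psi a b c) = kappa * Znk n1 (n1%:Z - m1%:Z) (Psi a b c) *
     (Znk n2 (n2%:Z - m2%:Z) (Psi a b c))^*) ->
  integralSO3 (fun Q => (complex.Re (f Q))%:E) =
  (complex.Re kappa * ((n1 == n2) && (n1%:Z - m1%:Z == n2%:Z - m2%:Z))%:R)%:E.
Proof.
move=> le1 le2 fE.
rewrite (@transform_dot (kappa * ((w n1)^-1 * (w n2)^-1)%:C) _ n1 n2 m1 m2)//; last first.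
  have alg (x y : R) (k u v : R[i]) :
      k * (x%:C * u) * (y%:C * v)^* = k * (x * y)%:C * u * v^*.
    by rewrite !rmorphM /= conj_real; ring.
  by move=> a b c; rewrite fE (Znk_Psi _ _ _ le1) (Znk_Psi _ _ _ le2) alg.
rewrite Re_realM -mulrA; congr ((_ * _)%:E).
have [->|_] := eqVneq n1 n2; last by rewrite /= mul0r mulr0.
case: eqP => _ /=; last by rewrite mul0r mulr0.
rewrite mul1r -w_sqr expr2; field.
by rewrite gt_eqF// w_gt0.
Qed.

(** Treats the real and the imaginary part at once: g is one of them and h is the
    matching cosine or sine. *)
Lemma measurable_Znk_part n m (h : R -> R) (g : R[i] -> R) :
  continuous h -> (forall (x y : R), g (x%:C * expi y) = x * h y) ->
  (forall (I : Type) (r : seq I) (F : I -> R[i]), g (\sum_(i <- r) F i) = \sum_(i <- r) g (F i)) ->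
  (m <= 2 * n)%N ->
  measurable_fun euler_box (fun p : R * R * R => g (Znk n (n%:Z - m%:Z) (Psi p.1.1 p.1.2 p.2))).
Proof.
move=> ch gE gsum le.
have -> : (fun p : R * R * R => g (Znk n (n%:Z - m%:Z) (Psi p.1.1 p.1.2 p.2))) =
  (fun p : R * R * R => \sum_(j < (2 * n).+1) (((w n)^-1 * transform_coef n m j) * (rotang (2 * n - j) j p.1.2)`_m) *
     h ((n%:Z - m%:Z)%:~R * p.1.1 + (n%:Z - j%:Z)%:~R * p.2)).
  apply/funext => -[[a b] c] /=; rewrite Znk_Psi// semicircle_Psi// mulr_sumr gsum.
  apply: eq_bigr => j _; rewrite -gE; congr g; rewrite expiD !rmorphM /=; ring.
have m11 : measurable_fun [set: R * R * R] (fun p => p.1.1).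
  exact: (measurableT_comp measurable_fst measurable_fst).
have m12 : measurable_fun [set: R * R * R] (fun p => p.1.2).
  exact: (measurableT_comp measurable_snd measurable_fst).
have m2 : measurable_fun [set: R * R * R] (fun p => p.2) by exact: measurable_snd.
apply: measurable_funTS; apply: measurable_sum => j.
apply: measurable_realfun.measurable_funM.
  apply: measurable_realfun.measurable_funM; first exact: measurable_cst.
  have mrot : measurable_fun [set: R] (fun b : R => (rotang (2 * n - j) j b)`_m).
    by apply: measurable_realfun.continuous_measurable_fun; exact: continuous_rot.
  exact: (measurableT_comp mrot m12).
have mh : measurable_fun [set: R] h by exact: measurable_realfun.continuous_measurable_fun.
apply: (measurableT_comp mh).
by apply: measurable_realfun.measurable_funD; apply: measurable_realfun.measurable_funM => //; exact: measurable_cst.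
Qed.

Lemma Znk_L2 n m : (m <= 2 * n)%N -> in_L2SO3 (@Znk R n (n%:Z - m%:Z)).
Proof.
move=> le; split.
- apply: (@measurable_Znk_part n m cos) => //; first exact: continuous_cos.
    by move=> x y; rewrite mulrC Re_realM mulrC.
  exact: Re_sum.
- apply: (@measurable_Znk_part n m sin) => //; first exact: continuous_sin.
    by move=> x y; rewrite mulrC Im_realM mulrC.
  exact: Im_sum.
- rewrite /sqnormSO3; under [X in integralSO3 X]eq_fun do rewrite normc_sqr.
  rewrite (@Znk_dot 1 _ n n m m le le) ?ltry//.
  by move=> a b c; rewrite mul1r.
Qed.

Lemma Znk_orthonormal n1 n2 m1 m2 : (m1 <= 2 * n1)%N -> (m2 <= 2 * n2)%N ->
  L2dotSO3 (@Znk R n1 (n1%:Z - m1%:Z)) (@Znk R n2 (n2%:Z - m2%:Z)) =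
  ((n1 == n2) && (n1%:Z - m1%:Z == n2%:Z - m2%:Z))%:R.
Proof.
move=> le1 le2; rewrite /L2dotSO3 /cintegralSO3.
rewrite (@Znk_dot 1 _ n1 n2 m1 m2 le1 le2); last by move=> a b c; rewrite mul1r.
have -> : (fun Q : 'M[R]_3 => (complex.Im (Znk n1 (n1%:Z - m1%:Z) Q * (Znk n2 (n2%:Z - m2%:Z) Q)^*))%:E) =
  (fun Q => (complex.Re (- 'i%C * (Znk n1 (n1%:Z - m1%:Z) Q * (Znk n2 (n2%:Z - m2%:Z) Q)^*)))%:E).
  apply/funext => Q; congr (_%:E); case: (_ * _) => x y /=.
  by rewrite oppr0 mul0r sub0r mulN1r opprK.
rewrite (@Znk_dot (- 'i%C) _ n1 n2 m1 m2 le1 le2); last by move=> a b c; rewrite mulrA.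
by rewrite /= oppr0 mul0r mul1r; case: (_ && _).
Qed.

Lemma w_bounds n :
  Num.sqrt (8 * pi)^-1 * n.+1%:R `^ (- (1 / 2)) <= (w n : R) <=
  Num.sqrt (4 / pi) * n.+1%:R `^ (- (1 / 2)).
Proof.
have x0 : 0 < n.+1%:R :> R by rewrite ltr0n.
have p0 := pi_gt0 R.
have pN : pi != 0 :> R by rewrite gt_eqF.
have xN : n.+1%:R != 0 :> R by rewrite gt_eqF.
have h8 : 0 <= (8 * pi)^-1 :> R by rewrite invr_ge0; exact: mulr_ge0 (ltW p0).
have h4 : 0 <= 4 / pi :> R by exact: divr_ge0 (ltW p0).
rewrite powRN div1r (powR12_sqrt (ltW x0)) -(sqrtrV (ltW x0)) wE.
rewrite -(sqrtrM _ h8) -(sqrtrM _ h4).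
have /andP[h1 h2] := @meridian_norm_bounds R n.
have mE : meridian_norm n / (8 * pi) = (n.+1%:R * meridian_norm n) * ((8 * pi)^-1 / n.+1%:R) :> R.
  by move: pN xN; move: (pi : R) (n.+1%:R : R) (meridian_norm n) => p x M hp hx; field; rewrite hp hx.
have k0 : 0 < (8 * pi)^-1 / n.+1%:R :> R by rewrite divr_gt0// invr_gt0 mulr_gt0.
apply/andP; split; apply: ler_wsqrtr; rewrite mE.
  by rewrite -[leLHS]mul1r ler_pM2r.
have -> : 4 / pi / n.+1%:R = 32 * ((8 * pi)^-1 / n.+1%:R) :> R.
  by move: pN xN; move: (pi : R) (n.+1%:R : R) => p x hp hx; field; rewrite hp hx.
by rewrite ler_pM2r.
Qed.

End InnerProducts.

Theorem theorem4p3 (R : realType) :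
  [/\ (forall (n : nat) (k : int), order_range n k ->
         L2normSO3 (semicircle (@Ynk R n k)) = w n),
      (forall (n : nat) (k : int), order_range n k ->
         forall Q : 'M[R]_3, SO3 Q ->
           semicircle (Ynk n k) Q = (w n)%:C * Znk n k Q),
      (forall (n : nat) (k : int), order_range n k -> in_L2SO3 (@Znk R n k)),
      (forall (n m : nat) (k l : int), order_range n k -> order_range m l ->
         L2dotSO3 (@Znk R n k) (@Znk R m l) = ((n == m) && (k == l))%:R)
    & exists C1 C2 : R, [/\ 0 < C1, 0 < C2 &
        forall n : nat, C1 * (n.+1)%:R `^ (- (1 / 2)) <= w n
                        <= C2 * (n.+1)%:R `^ (- (1 / 2))]].
Proof.
split.
- move=> n k /order_range_ex[m le ->].
  by rewrite L2norm_semicircle// wE.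
- move=> n k /order_range_ex[m le ->] Q hQ.
  exact: semicircle_Znk.
- move=> n k /order_range_ex[m le ->].
  exact: Znk_L2.
- move=> n n' k l /order_range_ex[m le ->] /order_range_ex[m' le' ->].
  exact: Znk_orthonormal.
- exists (Num.sqrt (8 * pi)^-1), (Num.sqrt (4 / pi)).
  have pp := pi_gt0 R.
  split; [by rewrite sqrtr_gt0 invr_gt0 mulr_gt0|by rewrite sqrtr_gt0 divr_gt0|].
  exact: w_bounds.
Qed.
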